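(* Let $\alpha,\beta\in CBV^*[0,1]$ and $v,w\in CBV[0,1]$ satisfy $v(t)+w(t)=1$ for all $t\in[0,1]$ and $\|\alpha\|+\|\alpha-\beta\|\cdot\|w\|_{BV}<1$. Let $p\in(1,+\infty]$, $q\in[1,+\infty)$ with $p^{-1}+q^{-1}=1$. Let $f\colon[0,1]\times\mathbb R\to\mathbb R$ satisfy: $t\mapsto f(t,u)$ is Lebesgue measurable for every $u$; $u\mapsto f(t,u)$ is continuous for a.e. $t$; there exist a non-decreasing $\psi\colon[0,+\infty)\to[0,+\infty)$ and $\phi\in L^p([0,1])$, $\phi\ge0$, with $|f(t,u)|\le\phi(t)\psi(|u|)$ for all $t,u$; and $\lim_{r\to+\infty}\psi(r)/r=0$. Let $k\colon[0,1]^2\to\mathbb R$ satisfy: $s\mapsto k(t,s)$ is in $L^q([0,1])$ for every $t$; there is $m\in L^q([0,1])$, $m\ge0$, with $\operatorname{var}_{[0,1]}k(\cdot,s)\le m(s)$ for a.e. $s$; and $\lim_{t\to\tau}\int_0^1|k(t,s)-k(\tau,s)|\phi(s)\,ds=0$ for every $\tau\in[0,1]$. Then the equation $x(t)=\alpha[x]v(t)+\beta[x]w(t)+\int_0^1k(t,s)f(s,x(s))\,ds$, $t\in[0,1]$, has a solution $x\in CBV[0,1]$.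
   Context: $BV[0,1]$ is the Banach space of real functions of bounded Jordan variation on $[0,1]$ with norm $\|f\|_{BV}=|f(0)|+\operatorname{var}_{[0,1]}f$; $CBV[0,1]$ is its closed subspace of continuous functions, and $CBV^*[0,1]$ its dual with the operator norm $\|\cdot\|$. *)

(* Defs.v *)
From mathcomp Require Import all_boot all_order all_algebra all_classical all_reals all_analysis.
Import Order.TTheory GRing.Theory Num.Theory numFieldNormedType.Exports.
Set Implicit Arguments. Unset Strict Implicit. Unset Printing Implicit Defensive.
Local Open Scope classical_set_scope.
Local Open Scope ring_scope.

Section Defs.
Context {R : realType}.

Definition var01 (f : R -> R) : \bar R := total_variation 0 1 f.

Definition bvnorm (f : R -> R) : R := `|f 0| + fine (var01 f).

Definition isCBV (f : R -> R) : Prop :=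
  {within `[0, 1], continuous f} /\ bounded_variation 0 1 f.

Definition isCBVdual (alpha : (R -> R) -> R) : Prop :=
  (forall (x y : R -> R) (c : R), isCBV x -> isCBV y ->
     alpha (fun t => c * x t + y t) = c * alpha x + alpha y) /\
  (exists C : R, forall x, isCBV x -> `|alpha x| <= C * bvnorm x).

Definition opnorm (alpha : (R -> R) -> R) : R :=
  sup [set `|alpha x| | x in [set x | isCBV x /\ bvnorm x <= 1]].

(* Lebesgue measure (completed, i.e. on Lebesgue measurable sets) *)
Definition lebT := caratheodory_type (@wlength R idfun)^*%mu.
Definition leb : {measure set lebT -> \bar R} := @completed_lebesgue_measure R.

Definition I01 : set lebT := `[0, 1].

Definition inLp (p : \bar R) (g : R -> R) : Prop :=
  measurable_fun I01 g /\
  match p with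
  | r%:E => (\int[leb]_(t in I01) (`|g t| `^ r)%:E < +oo)%E
  | +oo%E => exists M : R, {ae leb, forall t : lebT, I01 t -> `|g t| <= M}
  | -oo%E => False
  end.

End Defs.

(* Main.v *)
(* On [0, 1] the boundary operator is x |-> alpha[x] + (beta - alpha)[x] w, a rank-two
   operator L of norm < 1 on CBV, so x solves the equation iff x = (I - L)^-1 (F x), where
   F is the Hammerstein operator. Since psi is sublinear, T = (I - L)^-1 F preserves a
   sup-norm ball, also for bounded functions x that are merely such that s |-> f s (x s) is
   measurable. On that ball T is uniformly continuous for the sup norm (dominated
   convergence, by contradiction) and has equicontinuous image. Functions constant on the
   cells of a grid turn "T x = x at the grid points" into a fixed point problem in a cube;
   an approximate solution is given by Kuhn's cubical version of Sperner's lemma.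
   The images T x_n of finer and finer approximate solutions converge pointwise along an
   ultrafilter, hence, by equicontinuity, uniformly along a subsequence; the limit is a fixed
   point. *)
Require Import Defs.
From mathcomp Require Import all_boot all_order all_algebra all_classical all_reals all_analysis.
From mathcomp Require Import measurable_realfun perm zify ring lra.
Set Implicit Arguments. Unset Strict Implicit. Unset Printing Implicit Defensive.
Import Order.TTheory GRing.Theory Num.Theory numFieldNormedType.Exports.

(** * Kuhn's cubical lemma *)

(** Step functions lie outside CBV, so the discretisation has to run on a larger class and rely on
    the smoothing of [F]: from var k(.,s) <= m(s), the BV norm of the integral of k(t,s) h(s) is at
    most the integral of (|k(0,s)| + m(s)) |h(s)|, whatever the regularity of h. Hence [F] is
    continuous from the sup norm to the BV norm, and it is in the BV norm that the resolvent is
    controlled. Compactness is asked only in the sup norm: relative compactness of the image in BV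
    is never claimed. There the modulus of [T x] is that of w plus the weighted kernel modulus, both
    independent of x. The smallness condition enters through one number: with A = |alpha|, G =
    |alpha - beta|, W = |w|, the determinant of the 2 x 2 system is at least (1 - A)(1 - G W) - A W
    G = 1 - A - G W. *)

Lemma odd_card_involution (T : finType) (D : {set T}) (f : T -> T) :
  (forall x, x \in D -> f x \in D) -> (forall x, x \in D -> f (f x) = x) ->
  odd #|D| = odd #|[set x in D | f x == x]|.
Proof.
have [m] := ubnP #|D|; elim: m D => // m IH D Dm fD fK.
have [/existsP[x /andP[xD fx]]|/existsPn noD] :=
  boolP [exists x, (x \in D) && (f x != x)]; last first.
  congr (odd #|pred_of_set _|); apply/setP => x; rewrite inE.
  by have := noD x; case: (x \in D) => //=; rewrite negbK => ->.
(* Removing the two-point orbit of a moved point changes neither the parity of [D] nor its set of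
   fixed points. *)
pose D' := D :\ x :\ f x.
have cD : #|D| = #|D'|.+2.
  rewrite /D' (cardsD1 x) xD (cardsD1 (f x) (D :\ x)) !inE fx fD //.
have fix' : [set x in D | f x == x] = [set x in D' | f x == x].
  apply/setP => y; rewrite !inE.
  case: (eqVneq y (f x)) => [->|_] /=; first by rewrite fK // eq_sym (negPf fx) andbF.
  by case: (eqVneq y x) => [->|_] //=; rewrite (negPf fx) andbF.
rewrite fix' cD /= negbK; apply: IH.
- by move: Dm; rewrite cD; lia.
- move=> y; rewrite !inE => /and3P[y1 y2 yD]; rewrite fD // andbT.
  apply/andP; split; first by apply: contra y2 => /eqP e; rewrite -(fK y) // e fK.
  by apply: contra y1 => /eqP <-; rewrite fK.
- by move=> y; rewrite !inE => /and3P[_ _]; exact: fK.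
Qed.

(** * Labelled simplices: facets that carry every label but the top one *)

Section Partner.
Variables (N : nat) (L : 'I_N.+1 -> 'I_N.+1).

(** [L] labels the vertices of a simplex, and [k] stands for the facet opposite vertex [k]; the
    labels asked for are those below [N]. *)
Definition facet_full (k : 'I_N.+1) : bool :=
  [forall l : 'I_N, [exists j, (j != k) && (L j == l :> nat)]].

(** The other vertex with the label of [k]. Exchanging the two turns one full facet of the simplex
    into another. The default [k] does not arise under the assumptions of [twinP]. *)
Definition twin (k : 'I_N.+1) : 'I_N.+1 :=
  odflt k [pick j | (j != k) && (L j == L k)].

Hypothesis notfull : ~ forall l, exists j, L j = l.

(** The [N] vertices of the facet cover [N] labels, so no label is repeated. *)
Lemma facet_full_inj k : facet_full k -> {in [set~ k] &, injective L}.
Proof.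
move=> /forallP Fk; apply/imset_injP; rewrite eqn_leq leq_imset_card /=.
have sub : [set widen_ord (leqnSn N) l | l : 'I_N] \subset L @: [set~ k].
  apply/fintype.subsetP => _ /imsetP[l _ ->]; have /existsP[j /andP[jk /eqP Lj]] := Fk l.
  by apply/imsetP; exists j; rewrite ?inE //; apply/val_inj.
have := subset_leq_card sub; rewrite (card_imset _ (_ : injective (widen_ord _))).
  by rewrite cardsC1 !card_ord.
by move=> a b /(congr1 val) /= /val_inj.
Qed.

(** If no other vertex had the label of [k], that label could only be the top one, and the simplex
    would carry all labels. *)
Lemma twinP k : facet_full k -> [/\ twin k != k, L (twin k) = L k & facet_full (twin k)].
Proof.
move=> Fk; rewrite /twin; case: pickP => /= [j /andP[jk /eqP Lj]|no].
  split => //; apply/forallP => l; have /existsP[i /andP[ik /eqP Li]] := forallP Fk l.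
  have [ij|ij] := eqVneq i j; apply/existsP; last by exists i; rewrite ij Li eqxx.
  by exists k; rewrite eq_sym jk -Lj -ij Li eqxx.
case: notfull => l.
have [lN|lN] := ltnP l N.
  have /existsP[j /andP[_ /eqP Lj]] := forallP Fk (Ordinal lN).
  by exists j; apply/val_inj.
have [kN|kN] := ltnP (L k) N.
  have /existsP[j /andP[jk /eqP Lj]] := forallP Fk (Ordinal kN).
  have e : L j = L k by apply/val_inj.
  by have := no j; rewrite jk e eqxx.
by exists k; apply/val_inj => /=; have := ltn_ord l; have := ltn_ord (L k); lia.
Qed.

Lemma twinK k : facet_full k -> twin (twin k) = k.
Proof.
move=> Fk; have [tk Lt Ft] := twinP Fk; have [ttk Ltt _] := twinP Ft.
apply/eqP; apply: contraNT ttk => ttk; apply/eqP.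
by apply: (facet_full_inj Fk); rewrite ?inE //.
Qed.

End Partner.

(** * Pivoting through Kuhn's triangulation of a grid *)

Section Pivot.
Variables (M Q0 : nat).
Local Notation N := M.+1.
Local Notation Q := Q0.+1.

Local Notation state := ({ffun 'I_N -> 'I_Q} * {ffun 'I_N -> 'I_N} * 'I_N.+1)%type.

Implicit Types (q : {ffun 'I_N -> 'I_Q}) (rho : {ffun 'I_N -> 'I_N}) (s : state).

(* The simplex (q, rho) of Kuhn's triangulation: walking from q to q + (1,..,1),
   coordinate i is incremented at step rho i. *)
Definition vertex (q : {ffun 'I_N -> 'I_Q}) (rho : {ffun 'I_N -> 'I_N}) (j : nat)
  : {ffun 'I_N -> nat} := [ffun i => q i + (rho i < j)].

(** The neighbour across the facet opposite vertex 0: the first vertex is dropped and the coordinate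
    incremented first becomes the last one, which appends a new vertex. [shift_down] is the inverse
    move. [inord] gives a junk value if the neighbour would leave the grid; the lemmas exclude that
    case. *)
Definition shift_up (q : {ffun 'I_N -> 'I_Q}) (rho : {ffun 'I_N -> 'I_N}) :=
  ([ffun i => inord (q i + (rho i == 0 :> nat))] : {ffun 'I_N -> 'I_Q},
   [ffun i => ord_pred (rho i)] : {ffun 'I_N -> 'I_N}).

Definition shift_down (q : {ffun 'I_N -> 'I_Q}) (rho : {ffun 'I_N -> 'I_N}) :=
  ([ffun i => inord (q i - (rho i == M :> nat))] : {ffun 'I_N -> 'I_Q},
   [ffun i => ordS (rho i)] : {ffun 'I_N -> 'I_N}).

(** The neighbour across the facet opposite an inner vertex [k]: exchanging the steps into and out
    of vertex [k] replaces this vertex only. *)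
Definition swap_step (k : nat) (rho : {ffun 'I_N -> 'I_N}) : {ffun 'I_N -> 'I_N} :=
  [ffun i => tperm (inord k.-1) (inord k) (rho i)].

Lemma val_ord_pred (i : 'I_N) : ord_pred i = (if i == 0 :> nat then M else i.-1) :> nat.
Proof.
rewrite /=; have := ltn_ord i; case: eqP => [->|i0] iN; first by rewrite add0n /= modn_small.
by rewrite (_ : (i + N).-1 = i.-1 + N) ?modnDr ?modn_small; lia.
Qed.

Lemma val_ordS (i : 'I_N) : ordS i = (if i == M :> nat then 0 else i.+1) :> nat.
Proof.
rewrite /=; have := ltn_ord i; case: eqP => [->|i0] iN; first by rewrite modnn.
by rewrite modn_small; lia.
Qed.

Lemma vertex_shift_up q rho j : j < N -> (forall i, rho i = 0 :> nat -> q i < Q0) ->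
  vertex (shift_up q rho).1 (shift_up q rho).2 j = vertex q rho j.+1.
Proof.
move=> jN qP; apply/ffunP => i; rewrite !ffunE val_ord_pred inordK; last first.
  by have := qP i; have := ltn_ord (q i); case: eqP => // h; lia.
by case: eqP => h; have := ltn_ord (rho i); lia.
Qed.

Lemma vertex_shift_down q rho j : j < N -> (forall i, rho i = M :> nat -> 0 < q i) ->
  vertex (shift_down q rho).1 (shift_down q rho).2 j.+1 = vertex q rho j.
Proof.
move=> jN qP; apply/ffunP => i; rewrite !ffunE val_ordS inordK; last first.
  by have := ltn_ord (q i); lia.
by have := qP i; case: eqP => h; have := ltn_ord (rho i); lia.
Qed.

Lemma shift_upK q rho : (forall i, rho i = 0 :> nat -> q i < Q0) ->
  shift_down (shift_up q rho).1 (shift_up q rho).2 = (q, rho).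
Proof.
move=> qP; rewrite /shift_down /=; congr (_, _); apply/ffunP => i; rewrite !ffunE;
  last exact: ord_predK.
rewrite val_ord_pred; apply/ord_inj; have := ltn_ord (q i); have := ltn_ord (rho i).
have [/[dup] /qP ? ->|h] := eqVneq (rho i : nat) 0 => ? ?.
  by rewrite eqxx !inordK addn1 ?subn1.
have -> : ((rho i).-1 == M) = false by apply/eqP; lia.
by rewrite !inordK addn0 ?subn0.
Qed.

Lemma shift_downK q rho : (forall i, rho i = M :> nat -> 0 < q i) ->
  shift_up (shift_down q rho).1 (shift_down q rho).2 = (q, rho).
Proof.
move=> qP; rewrite /shift_up /=; congr (_, _); apply/ffunP => i; rewrite !ffunE;
  last exact: ordSK.
rewrite val_ordS; apply/ord_inj; have := ltn_ord (q i); have := ltn_ord (rho i).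
have [/[dup] /qP ? ->|h] := eqVneq (rho i : nat) M => ? ?.
  by rewrite eqxx /= !inordK ?subn1 ?addn1 ?prednK // ltnW.
by rewrite !inordK ?addn0 ?subn0.
Qed.

Lemma swap_stepK k rho : swap_step k (swap_step k rho) = rho.
Proof. by apply/ffunP => i; rewrite !ffunE tpermK. Qed.

Lemma vertex_swap k q rho j : 0 < k < N -> j != k ->
  vertex q (swap_step k rho) j = vertex q rho j.
Proof.
move=> /andP[k0 kN] jk; apply/ffunP => i; rewrite !ffunE; congr (_ + _).
by case: tpermP => [->|->|//]; rewrite !inordK; lia.
Qed.

Lemma injective_ffun_comp (g : 'I_N -> 'I_N) (rho : {ffun 'I_N -> 'I_N}) :
  injective g -> injectiveb rho -> injectiveb [ffun i => g (rho i)].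
Proof. by move=> gi /injectiveP ri; apply/injectiveP => a b; rewrite !ffunE => /gi/ri. Qed.

Variable ell : {ffun 'I_N -> nat} -> 'I_N.+1.

Definition label (s : state) (j : 'I_N.+1) : 'I_N.+1 := ell (vertex s.1.1 s.1.2 j).

(** A door is a pair of a simplex and one of its full facets, so a facet shared by two simplices is
    counted once from each side. Injectivity singles out the permutations among all functions
    [rho]. *)
Definition door (s : state) : bool := injectiveb s.1.2 && facet_full (label s) s.2.

(** The facet of vertices 0 to [M] lies in the hyperplane x_i = 0, where i is the coordinate
    incremented last; there is no cell beyond it. *)
Definition on_floor (s : state) : bool :=
  (s.2 == N :> nat) && [exists i, (s.1.2 i == M :> nat) && (s.1.1 i == 0 :> nat)].

Definition pivot (s : state) : state :=
  let: (q, rho, k) := s in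
  if k == 0 :> nat then (shift_up q rho, ord_max)
  else if k == N :> nat then
    if on_floor s then s else (shift_down q rho, ord0)
  else (q, swap_step k rho, k).

(** These conditions describe labelling by the first coordinate at which a boolean test fails. On
    the face where the last coordinate is 0, they force the label to be the first vanishing
    coordinate. *)
Hypothesis ell_top : forall (x : {ffun 'I_N -> nat}) i, x i = Q -> ell x != i :> nat.
Hypothesis ell_bot : forall (x : {ffun 'I_N -> nat}) i, x i = 0 -> ell x <= i.
Hypothesis ell_floor : forall x : {ffun 'I_N -> nat}, x ord_max = 0 ->
  forall i : 'I_N, i < ell x -> 0 < x i.
Hypothesis ell_zero : forall x : {ffun 'I_N -> nat}, x ord_max = 0 ->
  forall i : 'I_N, i = ell x :> nat -> x i = 0.

(** If [q i = Q0] for the coordinate incremented first, all vertices of the facet have i-th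
    coordinate [Q], and label i is missing from it. *)
Lemma door_top s : door s -> s.2 = 0 :> nat ->
  forall i, s.1.2 i = 0 :> nat -> s.1.1 i < Q0.
Proof.
case: s => [[q rho] k] /andP[_ /forallP /= Fk] k0 i ri; rewrite /= in k0 ri *.
rewrite ltn_neqAle -ltnS ltn_ord andbT; apply/eqP => qi.
have /existsP[j /andP[jk /eqP]] := Fk i; rewrite /label /= => e.
have := @ell_top (vertex q rho j) i; rewrite e eqxx => H.
suff /H: vertex q rho j i = Q by [].
rewrite ffunE ri qi; have: j != 0 :> nat by apply: contra jk => /eqP jz; apply/eqP/val_inj; rewrite /= jz k0.
lia.
Qed.

(** The two simplices share the facet, with the same vertices and hence the same labels; only the
    numbering of the vertices shifts. *)
Lemma pivot_door s : door s -> door (pivot s) /\ pivot (pivot s) = s.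
Proof.
case: s => [[q rho] k] Ds; have /andP[/= ri Fk] := Ds.
rewrite /pivot; case: ifPn => k0.
  have qP := door_top Ds (eqP k0).
  have eq_up : forall i, (shift_up q rho).2 i = M :> nat -> 0 < (shift_up q rho).1 i.
    move=> i; rewrite !ffunE val_ord_pred; have := qP i; rewrite /= => h.
    have := ltn_ord (rho i); have := ltn_ord (q i).
    by case: eqP h => r0 h ? ? ?; rewrite ?inordK; lia.
  have nf : ~~ on_floor (shift_up q rho, ord_max).
    rewrite /on_floor eqxx; apply/existsPn => i; apply/negP => /andP[/eqP h].
    by have := eq_up _ h; rewrite lt0n => /negP.
  split.
    apply/andP; split; first exact: injective_ffun_comp (@ord_pred_inj _) ri.
    apply/forallP => l; have /existsP[j /andP[jk lj]] := forallP Fk l.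
    have j0 : 0 < j by rewrite lt0n; apply: contra jk => /eqP jz; apply/eqP/val_inj; rewrite /= jz (eqP k0).
    have jN : j.-1 < N by have := ltn_ord j; lia.
    apply/existsP; exists (inord j.-1); rewrite /label /= inordK; last lia.
    rewrite -(inj_eq val_inj) /= inordK; last lia.
    rewrite vertex_shift_up // prednK // lj andbT; lia.
  rewrite (negPf nf) eqxx /= shift_upK //; congr (_, _).
  by apply/val_inj; rewrite /= (eqP k0).
case: ifPn => kN.
  case: ifPn => fl; first by rewrite (negPf k0) kN fl.
  have qP i : rho i = M :> nat -> 0 < q i.
    move=> rM; rewrite lt0n; apply: contra fl => q0; rewrite /on_floor kN.
    by apply/existsP; exists i; rewrite /= rM eqxx.
  split.
    apply/andP; split; first exact: injective_ffun_comp (@ordS_inj _) ri.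
    apply/forallP => l; have /existsP[j /andP[jk lj]] := forallP Fk l.
    have jN : j < N by have := ltn_ord j; move: jk; rewrite -(inj_eq val_inj) /= (eqP kN); lia.
    apply/existsP; exists (inord j.+1); rewrite /label /= inordK; last lia.
    by rewrite -(inj_eq val_inj) /= inordK // vertex_shift_down // lj.
  rewrite /= shift_downK //; congr (_, _).
  by apply/val_inj; rewrite /= (eqP kN).
have k0N : 0 < k < N by have := ltn_ord k; lia.
split; last by rewrite (negPf k0) (negPf kN) swap_stepK.
apply/andP; split; first exact: injective_ffun_comp perm_inj ri.
apply/forallP => l; have /existsP[j /andP[jk lj]] := forallP Fk l.
apply/existsP; exists j; rewrite jk /label /= vertex_swap //.
Qed.

(** Crossing an end facet switches the index between 0 and [N], and exchanging two steps alters a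
    permutation; only the explicit stop on the floor is left. *)
Lemma pivot_fixed s : door s -> pivot s = s -> on_floor s.
Proof.
case: s => [[q rho] k] Ds; have /andP[/= ri Fk] := Ds.
rewrite /pivot; case: ifPn => k0.
  by move=> /(congr1 (fun s : state => s.2 : nat)) /= e; move: k0; rewrite -e.
case: ifPn => kN.
  by case: ifPn => // _ /(congr1 (fun s : state => s.2 : nat)) /= e; move: k0; rewrite -e.
move=> /(congr1 (fun s : state => s.1.2)) /= e.
have k0N : 0 < k < N by have := ltn_ord k; lia.
have [g rg gr] := injF_bij (injectiveP _ ri).
have := congr1 (fun h : {ffun 'I_N -> 'I_N} => h (g (inord k))) e.
rewrite ffunE gr tpermR => /(congr1 val) /=; rewrite !inordK; lia.
Qed.

Lemma ord_increasing_id (rho : 'I_N -> 'I_N) :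
  {homo rho : i j / i < j} -> forall i, rho i = i.
Proof.
move=> inc; have le m (i : 'I_N) : i = m :> nat -> m <= rho i.
  elim: m i => // m IH i im; have mN : m < N by have := ltn_ord i; lia.
  have := IH (Ordinal mN) erefl; have : rho (Ordinal mN) < rho i by apply: inc => /=; lia.
  lia.
have ge m (i : 'I_N) : i + m = M -> rho i + m <= M.
  elim: m i => [|m IH] i im; first by have := ltn_ord (rho i); lia.
  have mN : i.+1 < N by lia.
  have := IH (Ordinal mN); rewrite /= => /(_ ltac:(lia)).
  have : rho i < rho (Ordinal mN) by apply: inc => /=; lia.
  lia.
move=> i; apply/val_inj; have := le i i erefl; have := ge (M - i) i.
have := ltn_ord i; rewrite /=; lia.
Qed.

Definition floor_door : state := ([ffun=> ord0], [ffun i => i], ord_max).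

(** If the facet lies in x_i0 = 0, its labels are at most i0; label [M] occurs, so i0 is the last
    coordinate and each label is the first zero coordinate. Label l at vertex j then gives q l = 0,
    j <= rho l, and rho l' < j for l' < l with q l' = 0. Thus q = 0 and rho is increasing, hence the
    identity. *)
Lemma floor_door_unique s : door s -> on_floor s -> s = floor_door.
Proof.
case: s => [[q rho] k] /andP[/= /injectiveP ri Fk] /andP[/= /eqP kN /existsP[i0]].
move=> /andP[/= /eqP ri0 /eqP qi0].
have lab_j (l : 'I_N) : exists2 j : nat, j < N & ell (vertex q rho j) = l :> nat.
  have /existsP[j /andP[jk /eqP lj]] := forallP Fk l; exists j => //.
  by have := ltn_ord j; move: jk; rewrite -(inj_eq val_inj) /= kN; lia.
have v0 (j : nat) : j < N -> vertex q rho j i0 = 0 by rewrite ffunE ri0 qi0; lia.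
have i0M : i0 = ord_max.
  have [j jN e] := lab_j ord_max; apply/val_inj => /=.
  have := ell_bot (v0 _ jN); rewrite e /=; have := ltn_ord i0; lia.
rewrite i0M in v0.
have qr (l : 'I_N) j : j < N -> ell (vertex q rho j) = l :> nat ->
    [/\ q l = 0 :> nat, j <= rho l & forall l' : 'I_N, l' < l -> q l' = 0 :> nat -> rho l' < j].
  move=> jN e; have := ell_zero (v0 _ jN) (esym e); rewrite ffunE => ql; split; [lia|lia|].
  move=> l' ll' q0; have := ell_floor (v0 _ jN) (i := l'); rewrite e ffunE q0; lia.
have q0 l : q l = 0 :> nat by have [j jN e] := lab_j l; have [] := qr _ _ jN e.
have rid : forall i, rho i = i.
  apply: ord_increasing_id => l' l ll'; have [j jN e] := lab_j l.
  by have [_ jr /(_ _ ll' (q0 _))] := qr _ _ jN e; lia.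
congr (_, _, _); last by apply/val_inj.
  by apply/ffunP => i; apply/val_inj; rewrite ffunE /= q0.
by apply/ffunP => i; rewrite ffunE rid.
Qed.

Lemma floor_doorP : door floor_door /\ pivot floor_door = floor_door.
Proof.
have fl : on_floor floor_door.
  by rewrite /on_floor eqxx; apply/existsP; exists ord_max; rewrite !ffunE /= eqxx.
split; last by rewrite /pivot /floor_door /= eqxx -/floor_door fl.
apply/andP; split; first by apply/injectiveP => a b; rewrite !ffunE.
(* Vertex l of this simplex has ones exactly at the coordinates below l, so its first zero
   coordinate is l. *)
apply/forallP => l; apply/existsP; exists (widen_ord (leqnSn _) l).
rewrite -(inj_eq val_inj) /= (ltn_eqF (ltn_ord l)) /=; apply/eqP.
rewrite /label /=; set x := vertex _ _ _.
have xE i : x i = (i < l) by rewrite /x !ffunE add0n.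
have xM : x ord_max = 0 by rewrite xE /=; have := ltn_ord l; lia.
have eM := ell_bot xM; rewrite /= in eM.
have eN : ell x < N by lia.
have := ell_zero xM (i := Ordinal eN) erefl; rewrite xE /= => h1.
have := ell_floor xM (i := l); rewrite xE; lia.
Qed.

(* Otherwise twin would be a fixed-point-free involution of the set of doors, on which
   pivot is an involution with exactly one fixed point. *)
Lemma full_simplex_exists :
  exists q rho, forall l : 'I_N.+1, exists j : 'I_N.+1, ell (vertex q rho j) = l.
Proof.
apply: contrapT => none.
have nf s : ~ forall l, exists j, label s j = l.
  by move=> h; apply: none; exists s.1.1, s.1.2 => l; have [j] := h l; exists j.
pose D := [set s : state | door s].
have fixp : [set s in D | pivot s == s] = [set floor_door].
  apply/setP => s; rewrite !inE; apply/andP/eqP => [[Ds /eqP ps]|->].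
    by apply: floor_door_unique => //; exact: pivot_fixed.
  by have [? ->] := floor_doorP.
have o1 : odd #|D|.
  rewrite (odd_card_involution (f := pivot)) ?fixp ?cards1 // => s; rewrite inE => /pivot_door[] //.
  by rewrite inE.
pose f (s : state) : state := (s.1, twin (label s) s.2).
have : ~~ odd #|D|.
  have fD s : s \in D -> [/\ f s \in D, f (f s) = s & f s != s].
    case: s => [[q rho] k]; rewrite !inE => /andP[ri Fk].
    have [t1 t2 t3] := twinP (nf _) Fk; split; first by apply/andP.
      by congr (_, _); exact: twinK (nf _) _ Fk.
    by apply: contra t1 => /eqP[] /(congr1 val) e; apply/eqP/val_inj.
  rewrite (odd_card_involution (f := f)); try by move=> s /fD[].
  rewrite (_ : [set _ in _ | _] = finset.set0) ?cards0 //.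
  by apply/setP => s; rewrite !inE; apply/negP => /andP[sD]; have [|_ _ /negP] := fD s; rewrite ?inE.
by rewrite o1.
Qed.

End Pivot.

(** * From boolean labels to a single label *)

Section FirstFalse.
Variables (N : nat) (b : 'I_N -> bool).

(** The extra value [N] means that [b] holds everywhere. *)
Definition first_false : 'I_N.+1 := inord (find (predC b) (enum 'I_N)).

Lemma first_falseE : first_false = find (predC b) (enum 'I_N) :> nat.
Proof. by rewrite inordK // ltnS (leq_trans (find_size _ _)) // size_enum_ord. Qed.

Lemma before_first_false (i : 'I_N) : i < first_false -> b i.
Proof.
by rewrite first_falseE => /(before_find i); rewrite nth_ord_enum /= => /negbFE.
Qed.

Lemma at_first_false (i : 'I_N) : i = first_false :> nat -> ~~ b i.
Proof.
rewrite first_falseE => e; have h : has (predC b) (enum 'I_N).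
  by rewrite has_find -e size_enum_ord.
by have := nth_find i h; rewrite -e nth_ord_enum.
Qed.

End FirstFalse.

(** In a simplex with all labels, the vertex with the top label passes every test and the vertex
    with label i fails test i; all its vertices lie in one unit cube. *)
Lemma kuhn_cubical (M P : nat) (lab : {ffun 'I_M.+1 -> nat} -> 'I_M.+1 -> bool) :
  (forall (x : {ffun 'I_M.+1 -> nat}) i, x i = 0 -> ~~ lab x i) ->
  (forall (x : {ffun 'I_M.+1 -> nat}) i, x i = P -> lab x i) ->
  exists q : {ffun 'I_M.+1 -> nat}, forall i c,
    exists2 a : {ffun 'I_M.+1 -> nat},
      (forall j, q j <= a j <= (q j).+1 /\ a j <= P) & lab a i = c.
Proof.
move=> bot top.
pose down (x : {ffun 'I_M.+1 -> nat}) := [ffun i => (x i).-1].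
(* An extra layer with an artificial labelling is glued below the last face, so
   that the boundary carries exactly one door. *)
pose lab' (x : {ffun 'I_M.+1 -> nat}) i :=
  if x ord_max == 0 then 0 < x i else lab (down x) i.
pose ell x := first_false (lab' x).
have lab'0 (x : {ffun 'I_M.+1 -> nat}) i : x i = 0 -> ~~ lab' x i.
  by move=> x0; rewrite /lab' x0; case: ifP => // _; apply: bot; rewrite ffunE x0.
have [|||| q [rho full]] := @full_simplex_exists M P ell.
- move=> x i xi; apply/negP => /eqP e; have /negP[] := at_first_false (esym e).
  by rewrite /lab' xi; case: ifP => // _; apply: top; rewrite ffunE xi.
- by move=> x i x0; rewrite leqNgt; apply: contra (lab'0 _ _ x0); exact: before_first_false.
- by move=> x x0 i /before_first_false; rewrite /lab' x0.
- by move=> x x0 i /at_first_false; rewrite /lab' x0 /= -eqn0Ngt => /eqP.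
have [jt jtE] := full ord_max.
have all1 i : lab' (vertex q rho jt) i.
  by apply: before_first_false; rewrite -/(ell _) jtE /=.
(* In a cell of the added layer the last coordinate is 0 or 1, and test [ord_max] fails at both
   values, so no vertex there can pass every test. *)
have q0 : 0 < q ord_max.
  rewrite lt0n; apply: contraTneq (all1 ord_max) => q0; rewrite /lab'.
  case: ifP => [/eqP -> //|_]; apply: bot; rewrite !ffunE q0; lia.
have lab'E j i : lab' (vertex q rho j) i = lab (down (vertex q rho j)) i.
  by rewrite /lab' ffunE addn_eq0 eqn0Ngt q0.
exists [ffun i => (q i : nat).-1] => i c.
have [j cE] : exists j, lab' (vertex q rho j) i = c.
  case: c; first by exists jt; exact: all1.
  have [j jE] := full (widen_ord (leqnSn _) i); exists j; apply/negbTE.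
  by apply: at_first_false; rewrite -/(ell _) jE.
exists (down (vertex q rho j)); last by rewrite -lab'E.
move=> l; rewrite !ffunE; have := ltn_ord (q l); lia.
Qed.

Local Open Scope classical_set_scope.
Local Open Scope ring_scope.

(** * Fixed points of uniformly continuous equicontinuous maps *)
Lemma exists_natSinv_lt (R : realType) (e : R) : 0 < e -> exists n : nat, n.+1%:R^-1 < e.
Proof.
move=> e0; near \oo => n; exists n; near: n.
by have := near_infty_natSinv_lt (PosNum e0).
Unshelve. all: by end_near. Qed.

Section FixedPoint.
Context {R : realType}.
Implicit Types (x y z : R -> R) (s t : R) (e d : R).

(** There are [n.+2] cells because the endpoint 1 has a cell of its own. *)
Definition grid_index (n : nat) (s : R) : 'I_n.+2 := inord (Num.truncn (n.+1%:R * s)).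

Definition grid_point (n : nat) (i : nat) : R := i%:R / n.+1%:R.

Lemma grid_pointP n s : s \in `[0, 1] ->
  grid_point n (grid_index n s) \in `[0, 1] /\
  `|s - grid_point n (grid_index n s)| < n.+1%:R^-1.
Proof.
rewrite !in_itv /= => /andP[s0 s1]; have N0 : 0 < n.+1%:R :> R by rewrite ltr0n.
have Ns0 : 0 <= n.+1%:R * s by rewrite mulr_ge0 // ltW.
have /andP[h1 h2] := truncn_itv Ns0.
have le : (Num.truncn (n.+1%:R * s) < n.+2)%N.
  by rewrite ltnS -(ler_nat R) (le_trans h1) // ler_piMr // ltW.
rewrite /grid_point /grid_index inordK //; set T := Num.truncn _ in h1 h2 le *.
have g0 : 0 <= T%:R / n.+1%:R :> R by rewrite divr_ge0.
have gs : T%:R / n.+1%:R <= s by rewrite ler_pdivrMr // mulrC.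
split; first by rewrite g0 (le_trans gs).
rewrite ger0_norm ?subr_ge0 // -(ltr_pM2l N0) mulrBr mulrCA !mulfV ?gt_eqF //.
by rewrite mulr1 ltrBlDl natr1.
Qed.

Definition step (n : nat) (c : 'I_n.+2 -> R) : R -> R := fun s => c (grid_index n s).

Variables (r : R) (adm : (R -> R) -> Prop) (T : (R -> R) -> R -> R).
Hypothesis r_gt0 : 0 < r.
Hypothesis adm_step : forall n (c : 'I_n.+2 -> R), (forall i, `|c i| <= r) -> adm (step c).
Hypothesis adm_le : forall x, adm x -> forall t, t \in `[0, 1] -> `|T x t| <= r.
Hypothesis T_unif : forall e, 0 < e -> exists2 d, 0 < d & forall x y, adm x -> adm y ->
  (forall t, t \in `[0, 1] -> `|x t - y t| <= d) ->
  forall t, t \in `[0, 1] -> `|T x t - T y t| <= e.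
Hypothesis T_equi : forall e, 0 < e -> exists2 d, 0 < d & forall x, adm x ->
  forall t t', t \in `[0, 1] -> t' \in `[0, 1] -> `|t - t'| < d -> `|T x t - T x t'| <= e.

(** The tests record the sign of [T x - x] at the grid points. In the cube found by [kuhn_cubical]
    both signs occur at every grid point, so [T x - x] is small there for any vertex of the cube;
    equicontinuity extends this to all of [0,1]. *)
Lemma approximate_fixed_point e : 0 < e ->
  exists2 x, adm x & forall t, t \in `[0, 1] -> `|T x t - x t| <= e.
Proof.
move=> e0; have e4 : 0 < e / 4 by lra.
have [d1 d1p uni] := T_unif e4; have [d2 d2p equi] := T_equi e4.
have [n nd2] := exists_natSinv_lt d2p.
have m0 : 0 < Num.min d1 (e / 4) / (2 * r) by rewrite divr_gt0 ?mulr_gt0 // lt_min d1p.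
have [p pm] := exists_natSinv_lt m0.
have p0 : 0 < p.+1%:R :> R by rewrite ltr0n.
(* Mesh of the values in [-r, r]: below [d1], so that [T_unif] compares two vertices of a cube, and
   below [e / 4]. *)
pose h := 2 * r / p.+1%:R.
have h0 : 0 < h by rewrite divr_gt0 // mulr_gt0.
have hm : h < Num.min d1 (e / 4) by move: pm; rewrite ltr_pdivlMr ?mulr_gt0 // mulrC.
have [hd1 he] : h < d1 /\ h < e / 4 by move: hm; rewrite lt_min => /andP.
pose val (c : {ffun 'I_n.+2 -> nat}) i := - r + (c i)%:R * h.
have hp : p.+1%:R * h = 2 * r by rewrite /h mulrC divfK // gt_eqF.
have val_le (c : {ffun 'I_n.+2 -> nat}) i : (c i <= p.+1)%N -> `|val c i| <= r.
  move=> cp; have : (c i)%:R * h <= p.+1%:R * h by rewrite ler_wpM2r ?ler_nat // ltW.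
  have : 0 <= (c i)%:R * h by rewrite mulr_ge0 // ltW.
  by rewrite hp /val ler_norml => ? ?; apply/andP; split; lra.
pose tt (i : 'I_n.+2) := grid_point n i : R.
have tt01 i : tt i \in `[0, 1].
  rewrite in_itv /= divr_ge0 //= ler_pdivrMr ?ltr0n // mul1r ler_nat.
  by rewrite -ltnS ltn_ord.
(* The value is forced at both ends of the range. This is still a valid sign, because |T x| <= r
   gives T x >= -r at the bottom and T x <= r at the top. *)
pose lab (c : {ffun 'I_n.+2 -> nat}) (i : 'I_n.+2) :=
  (c i != 0%N) && ((c i == p.+1) || (T (step (val c)) (tt i) <= val c i)).
have [||q qP] := @kuhn_cubical n.+1 p.+1 lab.
- by move=> x i xi; rewrite /lab xi.
- by move=> x i xi; rewrite /lab xi eqxx.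
have admv (c : {ffun 'I_n.+2 -> nat}) : (forall j, (q j <= c j <= (q j).+1)%N /\ (c j <= p.+1)%N) ->
    adm (step (val c)).
  by move=> cP; apply: adm_step => i; apply: val_le; have [] := cP i.
have lab_true (c : {ffun 'I_n.+2 -> nat}) i : adm (step (val c)) -> lab c i ->
    T (step (val c)) (tt i) <= val c i.
  move=> ac /andP[_ /orP[/eqP e1|//]]; rewrite /val e1 hp.
  by have := adm_le ac (tt01 i); rewrite ler_norml => /andP[_]; lra.
have lab_false (c : {ffun 'I_n.+2 -> nat}) i : adm (step (val c)) -> lab c i = false ->
    val c i <= T (step (val c)) (tt i).
  move=> ac /negbT; rewrite negb_and negbK => /orP[/eqP e1|].
    rewrite /val e1 mul0r addr0.
    by have := adm_le ac (tt01 i); rewrite ler_norml => /andP[].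
  by rewrite negb_or -ltNge => /andP[_ /ltW].
have [a aP _] := qP ord0 false; have aA := admv _ aP.
have near_a (c : {ffun 'I_n.+2 -> nat}) :
    (forall j, (q j <= c j <= (q j).+1)%N /\ (c j <= p.+1)%N) ->
    forall i, `|val c i - val a i| <= h.
  move=> cP i; have [/andP[c1 c2] _] := cP i; have [/andP[a1 a2] _] := aP i.
  rewrite /val opprD addrACA subrr add0r -mulrBl normrM (gtr0_norm h0) ler_piMl ?(ltW h0) //.
  have {}c2 : (c i <= a i + 1)%N by rewrite addn1 (leq_trans c2).
  have {}a2 : (a i <= c i + 1)%N by rewrite addn1 (leq_trans a2).
  move: c2 a2; rewrite -!(ler_nat R) !natrD => c2 a2.
  by rewrite ler_norml; apply/andP; split; lra.
have close (c : {ffun 'I_n.+2 -> nat}) i :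
    (forall j, (q j <= c j <= (q j).+1)%N /\ (c j <= p.+1)%N) ->
    `|T (step (val c)) (tt i) - T (step (val a)) (tt i)| <= e / 4.
  move=> cP; apply: uni => //; first exact: admv.
  by move=> t t01; rewrite (le_trans (near_a _ cP _)) // ltW.
exists (step (val a)) => // t t01; have [g01 gd] := grid_pointP n t01.
set i := grid_index n t in g01 gd.
have := equi _ aA _ _ t01 g01 (lt_trans gd nd2).
have [b bP lb] := qP i true; have [c cP lc] := qP i false.
have bT := lab_true _ _ (admv _ bP) lb; have cT := lab_false _ _ (admv _ cP) lc.
have := near_a _ bP i; have := near_a _ cP i.
have := close _ i bP; have := close _ i cP.
rewrite -/(tt i) /step -/i !ler_norml.
move=> /andP[? ?] /andP[? ?] /andP[? ?] /andP[? ?] /andP[? ?].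
by apply/andP; split; lra.
Qed.

(** A cluster point exists by compactness of [-r, r], and an ultrafilter converges to each of its
    cluster points. *)
Lemma ultrafilter_limit (U : set_system nat) (u : nat -> R) : UltraFilter U ->
  (forall n, `|u n| <= r) -> exists l : R, u @ U --> l.
Proof.
move=> UU ur; have F : (u @ U) `[- r, r]%classic.
  by apply: (@filterE nat U _ (u @^-1` `[- r, r])) => n; rewrite /= in_itv /= -ler_norml.
have [l [_ lc]] := @segment_compact R (- r) r (u @ U) _ F.
exists l => V lV; have [//|nV] := in_ultra_setVsetC (u @^-1` V) UU.
have [v [nv vV]] := lc (~` V) V nV lV; by [].
Qed.

(** One ultrafilter serves all points t at once, so the pointwise limit needs no diagonal
    extraction. Closeness on a finite grid, together with equicontinuity, makes it uniform. *)
Lemma limit_fixed_point : exists z, forall e, 0 < e ->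
  exists2 x, adm x & forall t, t \in `[0, 1] -> `|T x t - x t| <= e /\ `|x t - z t| <= e.
Proof.
have inv0 n : 0 < n.+1%:R^-1 :> R by rewrite invr_gt0 ltr0n.
pose x n := sval (cid2 (approximate_fixed_point (inv0 n))).
have xA n : adm (x n) by rewrite /x; case: cid2.
have xT n t : t \in `[0, 1] -> `|T (x n) t - x n t| <= n.+1%:R^-1.
  by rewrite /x; case: cid2 => /= y _; apply.
have [U [UU Uoo]] := @ultraFilterLemma nat \oo _.
have lim_ex t : exists l : R, t \in `[0, 1] -> T (x n) t @[n --> U] --> l.
  have [t01|t01] := boolP (t \in `[0, 1]); last by exists 0.
  have [l lP] := ultrafilter_limit UU (fun n => adm_le (xA n) t01); by exists l.
have [z zP] := choice lim_ex; exists z => e e0; have e8 : 0 < e / 8 by lra.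
have [d d0 equi] := T_equi e8; have [n nd] := exists_natSinv_lt d0.
pose close t := [set N | `|T (x N) t - z t| < e / 8].
have Uclose t : t \in `[0, 1] -> U (close t).
  by move=> /zP /cvgr_distC_lt /(_ _ e8).
pose tt (i : 'I_n.+2) := grid_point n i : R.
have tt01 i : tt i \in `[0, 1].
  rewrite in_itv /= divr_ge0 //= ler_pdivrMr ?ltr0n // mul1r ler_nat.
  by rewrite -ltnS ltn_ord.
have UG : U [set N | forall i, close (tt i) N].
  by apply: filter_forall => i; exact: Uclose.
have Us : U [set N : nat | N.+1%:R^-1 < e / 8].
  by apply: Uoo; have := near_infty_natSinv_lt (PosNum e8).
have [N [NG Ns]] := filter_ex (filterI UG Us).
exists (x N) => // t t01; have [g01 gd] := grid_pointP n t01.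
set i := grid_index n t in g01 gd.
(* An auxiliary index, depending on t, passes the modulus of [T (x N')] on to [z]: from [x N t] to
   [z t] there are six steps of at most [e / 8]. *)
have [N' [N'G N't]] := filter_ex (filterI UG (Uclose t t01)).
have := le_trans (xT N t t01) (ltW Ns); have := NG i; have := N'G i; rewrite /close /= -/(tt i) => h1 h2 h3.
have := equi _ (xA N) _ _ t01 g01 (lt_trans gd nd).
have := equi _ (xA N') _ _ t01 g01 (lt_trans gd nd).
move: h1 h2 h3 N't; rewrite /close /= -/(tt i) !ler_norml !ltr_norml.
move=> /andP[? ?] /andP[? ?] /andP[? ?] /andP[? ?] /andP[? ?] /andP[? ?].
by split; apply/andP; split; lra.
Qed.

Hypothesis adm_lim : forall (x : nat -> R -> R) z, (forall n, adm (x n)) ->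
  (forall t, t \in `[0, 1] -> x n t @[n --> \oo] --> z t) -> adm z.

Lemma exists_fixed_point : exists2 z, adm z & forall t, t \in `[0, 1] -> T z t = z t.
Proof.
have [z zP] := limit_fixed_point.
have inv0 n : 0 < n.+1%:R^-1 :> R by rewrite invr_gt0 ltr0n.
have zA : adm z.
  pose x n := sval (cid2 (zP _ (inv0 n))).
  apply: (adm_lim (x := x)) => [n|t t01]; first by rewrite /x; case: cid2.
  apply/cvgrPdistC_lt => e e0; near=> n; have ne : n.+1%:R^-1 < e.
    by near: n; have := near_infty_natSinv_lt (PosNum e0).
  rewrite /x; case: cid2 => /= y _ /(_ _ t01)[_ h]; exact: le_lt_trans h ne.
exists z => // t t01; apply/eqP; rewrite -subr_eq0 -normr_le0; apply/ler_addgt0Pr => e e0.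
rewrite add0r; have e3 : 0 < e / 3 by lra.
have [d d0 uni] := T_unif e3.
have [|x xA xP] := zP (Num.min d (e / 3)); first by rewrite lt_min d0.
have xz t' : t' \in `[0, 1] -> `|x t' - z t'| <= d.
  by move=> /xP[_]; rewrite le_min => /andP[].
have := uni _ _ xA zA xz _ t01; have [] := xP _ t01; rewrite !le_min => /andP[_ +] /andP[_ +].
rewrite !ler_norml => /andP[? ?] /andP[? ?] /andP[? ?].
by apply/andP; split; lra.
Unshelve. all: by end_near. Qed.

End FixedPoint.

(** * Functions of bounded variation and their dual *)

Section BoundedVariation.
Context {R : realType}.
Implicit Types (x y : R -> R) (a : (R -> R) -> R) (c M : R).

Lemma var01_fin x : isCBV x -> var01 x = (fine (var01 x))%:E.
Proof. by case=> _ /(bounded_variationP _ ler01) h; rewrite fineK. Qed.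

Lemma var01_ge0 x : 0 <= fine (var01 x).
Proof. by apply: fine_ge0; exact: total_variation_ge0 ler01. Qed.

Lemma bvnorm_ge0 x : 0 <= bvnorm x.
Proof. by rewrite /bvnorm addr_ge0 ?var01_ge0. Qed.

Lemma variation_le_var01 x s : isCBV x -> itv_partition 0 1 s ->
  variation 0 1 x s <= fine (var01 x).
Proof.
move=> xB sP; rewrite -lee_fin -var01_fin //; apply: ereal_sup_ubound.
by exists (variation 0 1 x s) => //; exact: variations_variation.
Qed.

Lemma variation_bound x M :
  (forall s, itv_partition 0 1 s -> variation 0 1 x s <= M) ->
  bounded_variation 0 1 x /\ fine (var01 x) <= M.
Proof.
move=> H; have bx : bounded_variation 0 1 x by exists M => _ [s /H ? <-].
split=> //; rewrite -lee_fin fineK; last exact/(bounded_variationP _ ler01).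
by apply: ge_ereal_sup => _ [_ [s /H sM <-] <-]; rewrite lee_fin.
Qed.

Lemma itv_partition_nth (a b d : R) s i : itv_partition a b s -> (i <= size s)%N ->
  a <= nth d (a :: s) i <= b.
Proof.
elim: s a i => [|x s IH] a [|i]; rewrite /itv_partition /=.
- by move=> [_ /eqP ->]; rewrite lexx.
- by move=> _ /[!ltn0].
- move=> [/andP[ax xs] lb] _; rewrite lexx /=.
  have /andP[_] := IH x 0%N (conj xs lb) isT.
  by apply: le_trans; rewrite /= ltW.
- move=> [/andP[ax xs] lb] si; have /andP[h ->] := IH x i (conj xs lb) si.
  by rewrite andbT (le_trans (ltW ax)).
Qed.

Lemma variation_lincomb x y c s :
  variation 0 1 (fun t => c * x t + y t) s <=
  `|c| * variation 0 1 x s + variation 0 1 y s.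
Proof.
rewrite /variation mulr_sumr -big_split /=; apply: ler_sum => i _.
by rewrite -normrM (le_trans _ (ler_normD _ _)) // opprD addrACA mulrBr.
Qed.

Lemma isCBV_lincomb x y c : isCBV x -> isCBV y ->
  isCBV (fun t => c * x t + y t) /\
  bvnorm (fun t => c * x t + y t) <= `|c| * bvnorm x + bvnorm y.
Proof.
move=> xB yB; have [|bv le] := @variation_bound (fun t => c * x t + y t)
    (`|c| * fine (var01 x) + fine (var01 y)).
  move=> s sP; apply: le_trans (variation_lincomb _ _ _ _) _.
  by rewrite lerD ?ler_wpM2l ?variation_le_var01.
split; last first.
  rewrite /bvnorm mulrDr addrACA lerD // -normrM; exact: ler_normD.
split=> //; apply/subspace_continuousP => t t01.
have /subspace_continuousP/(_ t t01) cx := xB.1.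
have /subspace_continuousP/(_ t t01) cy := yB.1.
by apply: cvgD cy; apply: cvgM cx; exact: cvg_cst.
Qed.

Lemma isCBV_cst c : isCBV (fun=> c : R).
Proof.
have [|bv _] := @variation_bound (fun=> c) 0.
  by move=> s _; rewrite /variation big1 // => i _; rewrite subrr normr0.
split=> // t; exact: cst_continuous.
Qed.

Lemma bvnorm_cst c : bvnorm (fun=> c : R) = `|c|.
Proof.
have [|_ le0] := @variation_bound (fun=> c) 0.
  by move=> s _; rewrite /variation big1 // => i _; rewrite subrr normr0.
by rewrite /bvnorm (_ : fine _ = 0) ?addr0 //; apply/le_anti; rewrite le0 var01_ge0.
Qed.

Lemma isCBV_sub x y : isCBV x -> isCBV y -> isCBV (fun t => x t - y t).
Proof.
move=> xB yB; have [+ _] := isCBV_lincomb (-1) yB xB.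
by congr isCBV; apply/funext => t; rewrite mulN1r addrC.
Qed.

Lemma isCBV_scale x c : isCBV x -> isCBV (fun t => c * x t).
Proof.
move=> xB; have [+ _] := isCBV_lincomb c xB (isCBV_cst 0).
by congr isCBV; apply/funext => t; rewrite addr0.
Qed.

Lemma bvnorm_scale x c : isCBV x -> bvnorm (fun t => c * x t) <= `|c| * bvnorm x.
Proof.
move=> xB; have [_] := isCBV_lincomb c xB (isCBV_cst 0).
rewrite bvnorm_cst normr0 addr0; congr (bvnorm _ <= _).
by apply/funext => t; rewrite addr0.
Qed.

Lemma le_bvnorm x t : isCBV x -> 0 <= t <= 1 -> `|x t| <= bvnorm x.
Proof.
move=> xB /andP[t0 t1]; rewrite -[x t](subrK (x 0)) addrC.
rewrite (le_trans (ler_normD _ _)) // lerD2l -lee_fin -var01_fin // /var01.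
rewrite (total_variationD x t0 t1) (le_trans (total_variation_ge x t0)) //.
by rewrite leeDl // total_variation_ge0.
Qed.

(** Functions are defined on the whole line, while identities such as the linearity of the kernel
    operator are available on [0,1] only. *)
Lemma isCBV_eq_on x y : {in `[0, 1], x =1 y} -> isCBV x -> isCBV y /\ bvnorm x = bvnorm y.
Proof.
move=> xy [cx bx].
have e0 : x 0 = y 0 by apply: xy; rewrite in_itv /= lexx ler01.
have es s : itv_partition 0 1 s -> variation 0 1 x s = variation 0 1 y s.
  move=> sP; rewrite /variation !big_nat; apply: eq_bigr => i /andP[_ si] /=.
  have h j : (j <= size s)%N -> x (nth 1 (0 :: s) j) = y (nth 1 (0 :: s) j).
    by move=> js; rewrite xy // in_itv /=; exact: itv_partition_nth sP js.
  by rewrite -(h i.+1) // -(h i) // ltnW.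
have ev : variations 0 1 x = variations 0 1 y.
  by apply/seteqP; split=> _ [s sP <-]; rewrite /= ?es // -?es //; exists s => //; rewrite es.
split; last by rewrite /bvnorm e0 /var01 /total_variation ev.
split; last by rewrite /bounded_variation -ev.
apply: subspace_eq_continuous cx => t; rewrite inE => t01; exact: xy.
Qed.

Section Dual.
Variable a : (R -> R) -> R.
Hypothesis aD : isCBVdual a.

Lemma dual_lincomb x y c : isCBV x -> isCBV y ->
  a (fun t => c * x t + y t) = c * a x + a y.
Proof. by case: aD => + _; apply. Qed.

Lemma dual0 : a (fun=> 0) = 0.
Proof.
have := dual_lincomb 1 (isCBV_cst 0) (isCBV_cst 0).
rewrite (_ : (fun _ => 1 * 0 + 0) = (fun=> 0 : R)); last by apply/funext => ?; rewrite mulr0 addr0.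
by move=> h; lra.
Qed.

Lemma dual_scale x c : isCBV x -> a (fun t => c * x t) = c * a x.
Proof.
move=> xB; have := dual_lincomb c xB (isCBV_cst 0); rewrite dual0 addr0 => <-.
by congr a; apply/funext => t; rewrite addr0.
Qed.

Lemma dual_sub x y : isCBV x -> isCBV y -> a (fun t => x t - y t) = a x - a y.
Proof.
move=> xB yB; have := dual_lincomb (-1) yB xB; rewrite mulN1r addrC => <-.
by congr a; apply/funext => t; rewrite mulN1r addrC.
Qed.

Lemma opnorm_ub : has_ubound [set `|a x| | x in [set x | isCBV x /\ bvnorm x <= 1]].
Proof.
have [_ [C CP]] := aD; exists `|C| => _ [x [xB x1] <-].
rewrite (le_trans (CP _ xB)) // (le_trans (ler_wpM2r (bvnorm_ge0 _) (ler_norm C))) //.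
by rewrite ler_piMr.
Qed.

Lemma opnorm_ge0 : 0 <= opnorm a.
Proof.
apply: le_trans (normr_ge0 (a (fun=> 0))) _.
apply: (ub_le_sup opnorm_ub); exists (fun=> 0) => //.
by split; [exact: isCBV_cst|rewrite bvnorm_cst normr0].
Qed.

(** Normalising [x] reduces to the unit ball. If the norm is 0, [x] may still be nonzero outside
    [0,1], and the bound in the definition of the dual gives [a x = 0]. *)
Lemma le_opnorm x : isCBV x -> `|a x| <= opnorm a * bvnorm x.
Proof.
move=> xB; have [x0|x0] := eqVneq (bvnorm x) 0.
  by have [_ [C /(_ _ xB)]] := aD; rewrite x0 !mulr0.
have xp : 0 < bvnorm x by rewrite lt_def x0 bvnorm_ge0.
rewrite -ler_pdivrMr //; apply: (ub_le_sup opnorm_ub).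
exists (fun t => (bvnorm x)^-1 * x t); last first.
  by rewrite dual_scale // normrM ger0_norm ?invr_ge0 ?bvnorm_ge0 // mulrC.
split; first exact: isCBV_scale.
by rewrite (le_trans (bvnorm_scale _ xB)) // ger0_norm ?invr_ge0 ?bvnorm_ge0 // mulVf.
Qed.

End Dual.

Lemma isCBVdual_sub a b : isCBVdual a -> isCBVdual b -> isCBVdual (fun x => a x - b x).
Proof.
move=> aD bD; split=> [x y c xB yB|].
  by rewrite !dual_lincomb //; ring.
exists (opnorm a + opnorm b) => x xB; rewrite (le_trans (ler_normB _ _)) // mulrDl.
by rewrite lerD ?le_opnorm.
Qed.

End BoundedVariation.

(** * Inverting the boundary operator *)

Section Resolvent.
Context {R : realType}.
Variables (alpha beta : (R -> R) -> R) (v w : R -> R).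
Hypotheses (aD : isCBVdual alpha) (bD : isCBVdual beta).
Hypothesis wB : isCBV w.
Hypothesis vw1 : forall t, `[0, 1]%classic t -> v t + w t = 1.
Hypothesis small : opnorm alpha + opnorm (fun x => alpha x - beta x) * bvnorm w < 1.

(* As v = 1 - w on [0, 1], the boundary operator is
   x |-> alpha[x] + gamma[x] w with gamma = beta - alpha, and inverting
   I - L amounts to solving a 2 x 2 linear system for (alpha[x], gamma[x]). *)
Let gamma x := beta x - alpha x.
Let a1 := alpha (fun=> 1).
Let aw := alpha w.
Let g1 := gamma (fun=> 1).
Let gw := gamma w.
Let det := (1 - a1) * (1 - gw) - aw * g1.

Let gD : isCBVdual gamma. Proof. exact: isCBVdual_sub. Qed.

(** All four coefficients are bounded by the operator norms, the constant function 1 having norm 1;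
    the two cross terms of the lower bound cancel. *)
Let det_gt0 : 0 < det.
Proof.
have dD := isCBVdual_sub aD bD.
have gE x : `|gamma x| = `|alpha x - beta x| by rewrite /gamma distrC.
pose G := opnorm (fun x => alpha x - beta x); have sm : opnorm alpha + G * bvnorm w < 1 := small.
have G0 : 0 <= G by exact: opnorm_ge0.
have A0 := opnorm_ge0 aD; have W0 := bvnorm_ge0 w.
have := le_opnorm aD (isCBV_cst 1); rewrite bvnorm_cst normr1 mulr1 -/a1 => /ler_normlP[_ ha1].
have := le_opnorm dD (isCBV_cst 1); rewrite bvnorm_cst normr1 mulr1 -gE -/g1 -/G => hg1.
have haw := le_opnorm aD wB; rewrite -/aw in haw.
have := le_opnorm dD wB; rewrite -gE -/gw -/G => /ler_normlP[_ hgw].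
have p1 : aw * g1 <= opnorm alpha * bvnorm w * G.
  by rewrite (le_trans (ler_norm _)) // normrM ler_pM.
have GW0 : 0 <= G * bvnorm w by rewrite mulr_ge0.
have p2 : (1 - opnorm alpha) * (1 - G * bvnorm w) <= (1 - a1) * (1 - gw).
  by apply: ler_pM; lra.
rewrite /det; apply: (@lt_le_trans _ _ (1 - (opnorm alpha + G * bvnorm w))); first lra.
apply: le_trans (lerB p2 p1); rewrite le_eqVlt; apply/orP; left; apply/eqP; ring.
Qed.

(** Cramer's rule for (1 - a1) A - aw D = alpha[y] and -g1 A + (1 - gw) D = gamma[y], obtained by
    applying alpha and gamma to x = A + D w + y. *)
Let cA y := (1 - gw) / det * alpha y + aw / det * gamma y.
Let cD y := g1 / det * alpha y + (1 - a1) / det * gamma y.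

Let resolvent (y : R -> R) : R -> R := fun t => cA y + cD y * w t + y t.

Let resolvent_isCBV y : isCBV y -> isCBV (resolvent y).
Proof.
move=> yB; have [h _] := isCBV_lincomb (cD y) wB yB.
have [+ _] := isCBV_lincomb 1 (isCBV_cst (cA y)) h.
by congr isCBV; apply/funext => t; rewrite mul1r addrA.
Qed.

Let dual_resolvent (a : (R -> R) -> R) y : isCBVdual a -> isCBV y ->
  a (resolvent y) = cA y * a (fun=> 1) + cD y * a w + a y.
Proof.
move=> daD yB; have [h _] := isCBV_lincomb (cD y) wB yB.
rewrite -addrA -(dual_lincomb daD (cD y) wB yB) -(dual_lincomb daD _ (isCBV_cst 1) h).
by congr a; apply/funext => t; rewrite mulr1 addrA.
Qed.

Let coef_bound (p1 p2 : R) : exists2 C, 0 <= C &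
  forall y, isCBV y -> `|p1 * alpha y + p2 * gamma y| <= C * bvnorm y.
Proof.
exists (`|p1| * opnorm alpha + `|p2| * opnorm gamma).
  by rewrite addr_ge0 // mulr_ge0 // opnorm_ge0.
move=> y yB; rewrite (le_trans (ler_normD _ _)) // !normrM mulrDl -!mulrA.
by rewrite lerD // ler_wpM2l // le_opnorm.
Qed.

Lemma resolvent_exists : exists (C : R) (S : (R -> R) -> R -> R), 0 <= C /\
  forall y, isCBV y -> [/\ isCBV (S y),
    forall t, t \in `[0, 1] ->
      S y t = alpha (S y) * v t + beta (S y) * w t + y t,
    forall t, t \in `[0, 1] -> `|S y t| <= C * bvnorm y,
    forall y', isCBV y' -> forall t, t \in `[0, 1] ->
      `|S y t - S y' t| <= C * bvnorm (fun s => y s - y' s) &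
    forall t t', t \in `[0, 1] -> t' \in `[0, 1] ->
      `|S y t - S y t'| <= C * bvnorm y * `|w t - w t'| + `|y t - y t'|].
Proof.
have [CA CA0 hA] := coef_bound ((1 - gw) / det) (aw / det).
have [CD CD0 hD] := coef_bound (g1 / det) ((1 - a1) / det).
have W0 := bvnorm_ge0 w.
(* [CA], [CD * bvnorm w] and 1 bound the three terms of the resolvent; the separate [CD] is for the
   modulus of continuity. *)
exists (CA + CD + CD * bvnorm w + 1), resolvent; split.
  by rewrite !addr_ge0 // mulr_ge0.
have bound y : isCBV y -> forall t, t \in `[0, 1] ->
    `|resolvent y t| <= (CA + CD + CD * bvnorm w + 1) * bvnorm y.
  move=> yB t t01; have Y0 := bvnorm_ge0 y; rewrite /resolvent.
  rewrite (le_trans (ler_normD _ _)) // [leRHS]mulrDl mul1r lerD ?(le_bvnorm yB) //.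
  rewrite (le_trans (ler_normD _ _)) // normrM [in leRHS]mulrDl [in leRHS]mulrDl -addrA lerD //; first exact: hA.
  apply: (@le_trans _ _ (CD * bvnorm w * bvnorm y)); last by rewrite lerDr mulr_ge0.
  by rewrite mulrAC ler_pM // ?hD // le_bvnorm.
move=> y yB; have Y0 := bvnorm_ge0 y; split; first exact: resolvent_isCBV.
- move=> t t01; have -> : v t = 1 - w t by rewrite -(vw1 t01) addrK.
  have ea : alpha (resolvent y) = cA y.
    rewrite dual_resolvent // -/a1 -/aw /cA /cD /det; field.
    by rewrite -/det gt_eqF.
  have eg : gamma (resolvent y) = cD y.
    rewrite dual_resolvent // -/g1 -/gw /cA /cD /det; field.
    by rewrite -/det gt_eqF.
  have -> : beta (resolvent y) = cD y + cA y by rewrite -ea -eg /gamma subrK.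
  rewrite ea /resolvent; ring.
- exact: bound yB.
- move=> y' y'B t t01; have dB := isCBV_sub yB y'B.
  have -> : resolvent y t - resolvent y' t = resolvent (fun s => y s - y' s) t.
    rewrite /resolvent /cA /cD !(dual_sub aD yB y'B) !(dual_sub gD yB y'B); ring.
  exact: bound dB t t01.
- move=> t t' t01 t'01.
  have -> : resolvent y t - resolvent y t' = cD y * (w t - w t') + (y t - y t').
    rewrite /resolvent; ring.
  rewrite (le_trans (ler_normD _ _)) // lerD // normrM ler_wpM2r //.
  rewrite (le_trans (hD _ yB)) // ler_wpM2r //.
  have := mulr_ge0 CD0 W0; lra.
Qed.

End Resolvent.

(** * Kernel operators *)

Section LebesgueI01.
Context {R : realType}.
Local Notation mu := (@leb R).
Local Notation I := (@I01 R).

Lemma measurable_lebT (A : set R) : measurable A -> measurable (A : set (@lebT R)).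
Proof. by move=> mA; apply: sub_caratheodory; exact: mA. Qed.

Lemma measurable_I01 : measurable (I : set (@lebT R)).
Proof. by apply: measurable_lebT; exact: measurable_itv. Qed.

Lemma measurable_norm_I01 (f : R -> R) :
  measurable_fun I f -> measurable_fun I (fun s : @lebT R => `|f s|).
Proof. by move=> mf; apply: measurableT_comp. Qed.

Lemma measurable_sub_I01 (f g : R -> R) : measurable_fun I f -> measurable_fun I g ->
  measurable_fun I (fun s : @lebT R => f s - g s).
Proof. by move=> mf mg; apply: measurable_funB. Qed.

Lemma measurable_add_I01 (f g : R -> R) : measurable_fun I f -> measurable_fun I g ->
  measurable_fun I (fun s : @lebT R => f s + g s).
Proof. by move=> mf mg; apply: measurable_funD. Qed.

Lemma measurable_mul_I01 (f g : R -> R) : measurable_fun I f -> measurable_fun I g ->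
  measurable_fun I (fun s : @lebT R => f s * g s).
Proof. by move=> mf mg; apply: measurable_funM. Qed.

Lemma integrableD_I01 (f g : R -> R) :
  mu.-integrable I (EFin \o f) -> mu.-integrable I (EFin \o g) ->
  mu.-integrable I (EFin \o (fun s => f s + g s)).
Proof. by move=> fi gi; exact: (integrableD measurable_I01 fi gi). Qed.

Lemma integrableB_I01 (f g : R -> R) :
  mu.-integrable I (EFin \o f) -> mu.-integrable I (EFin \o g) ->
  mu.-integrable I (EFin \o (fun s => f s - g s)).
Proof. by move=> fi gi; exact: (integrableB measurable_I01 fi gi). Qed.

Lemma integrableZ_I01 (c : R) (f : R -> R) :
  mu.-integrable I (EFin \o f) -> mu.-integrable I (EFin \o (fun s => c * f s)).
Proof. by move=> fi; exact: (integrableZl measurable_I01 c fi). Qed.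

Lemma eq_integrable_I01 (f g : R -> R) : f =1 g ->
  mu.-integrable I (EFin \o f) -> mu.-integrable I (EFin \o g).
Proof. by move=> /funext ->. Qed.

Lemma le_integrable_I01 (f g : R -> R) : measurable_fun I f ->
  (forall s, I s -> `|f s| <= g s) ->
  mu.-integrable I (EFin \o g) -> mu.-integrable I (EFin \o f).
Proof.
move=> mf fg; apply: le_integrable; [exact: measurable_I01|exact/measurable_EFinP|].
by move=> s Is; rewrite /= lee_fin (le_trans (fg s Is)) // ler_norm.
Qed.

Lemma ae_le_Rintegral_I01 (f g : R -> R) :
  mu.-integrable I (EFin \o f) -> mu.-integrable I (EFin \o g) ->
  (forall s, I s -> 0 <= f s) -> (forall s, I s -> 0 <= g s) ->
  {ae mu, forall s : @lebT R, I s -> f s <= g s} ->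
  Rintegral mu I f <= Rintegral mu I g.
Proof.
move=> fi gi f0 g0 fg; rewrite /Rintegral fine_le ?integrable_fin_num //;
  try exact: measurable_I01.
apply: ae_ge0_le_integral; try exact: measurable_I01.
- by move=> s Is; rewrite lee_fin f0.
- by case/integrableP: fi.
- by move=> s Is; rewrite lee_fin g0.
- by case/integrableP: gi.
- by apply: filterS fg => s h Is; rewrite lee_fin h.
Qed.

(** Setting all functions to 0 on a null set makes the convergence hold everywhere; completeness of
    the measure returns to [g]. *)
Lemma ae_measurable_cvg_I01 (f : nat -> R -> R) (g : R -> R) :
  (forall n, measurable_fun I (f n)) ->
  {ae mu, forall s : @lebT R, I s -> f n s @[n --> \oo] --> g s} ->
  measurable_fun I g.
Proof.
move=> mf [Z [mZ Z0 sub]]; have mI := measurable_I01.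
have mr (h : R -> R) : measurable_fun I h -> measurable_fun I (fun s : @lebT R => if s \in Z then 0 else h s).
  move=> mh; apply: measurable_fun_if; first exact: mI.
  - apply: (measurable_fun_bool true); rewrite (_ : _ `&` _ = I `&` Z); first exact: measurableI.
    by apply/seteqP; split=> s [Is sZ]; split=> //; [exact: set_mem|exact: mem_set].
  - exact: measurable_cst.
  - by apply: measurable_funS mh; [exact: mI|exact: subIsetl].
have m0 : measurable_fun I (fun s : @lebT R => if s \in Z then 0 else g s).
  apply: (measurable_fun_cvg (h := fun n (s : @lebT R) => if s \in Z then 0 else f n s)) => [n|s Is].
    exact: mr.
  case: ifPn => [_|sZ]; first exact: cvg_cst.
  apply: contrapT => nc; move/negP: sZ; apply; rewrite inE; apply: sub => /= /(_ Is).
  exact: nc.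
apply/measurable_EFinP; apply: (ae_measurable_fun (@completed_lebesgue_measure_is_complete R) _
  (f := EFin \o (fun s : @lebT R => if s \in Z then 0 else g s))); last exact/measurable_EFinP.
exists Z; split=> // s /= h; apply: contrapT => sZ; apply: h => Is.
by case: ifPn => //; rewrite inE.
Qed.

End LebesgueI01.

(** It is applied to |phi| and |m|, so nonnegativity can be required at every point. The exponents p
    and q survive only as integrability of the two products with the weight. *)
Record admissible_kernel {R : realType} (k : R -> R -> R) (phi m : R -> R) : Prop := {
  kernel_weight_ge0 : forall s, 0 <= phi s;
  kernel_variation_ge0 : forall s, 0 <= m s;
  kernel_measurable : forall t, `[0, 1]%classic t -> measurable_fun (@I01 R) (k t);
  kernel_weight_measurable : measurable_fun (@I01 R) phi;
  kernel_variation_measurable : measurable_fun (@I01 R) m;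
  kernel_integrable : forall t, `[0, 1]%classic t ->
    (@leb R).-integrable (@I01 R) (EFin \o (fun s => `|k t s| * phi s));
  kernel_variation_integrable :
    (@leb R).-integrable (@I01 R) (EFin \o (fun s => m s * phi s));
  kernel_variation_le : {ae (@leb R), forall s : @lebT R, `[0, 1]%classic s ->
    (var01 (fun t => k t s) <= (m s)%:E)%E};
  kernel_cvg : forall tau, `[0, 1]%classic tau ->
    (fun t => (\int[@leb R]_(s in (@I01 R)) (`|k t s - k tau s| * phi s)%:E)%E)
      @ within (`[0, 1]%classic : set R) (nbhs tau) --> 0%:E }.

Section KernelOperator.
Context {R : realType}.
Local Notation mu := (@leb R).
Local Notation I := (@I01 R).
Implicit Types (h : R -> R) (c t : R).
Variables (k : R -> R -> R) (phi m : R -> R).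
Hypothesis kA : admissible_kernel k phi m.

Let phi_ge0 := kernel_weight_ge0 kA.
Let m_ge0 := kernel_variation_ge0 kA.
Let mk := kernel_measurable kA.
Let mphi := kernel_weight_measurable kA.
Let mm := kernel_variation_measurable kA.
Let ik := kernel_integrable kA.
Let im := kernel_variation_integrable kA.

Definition dominated (h : R -> R) :=
  measurable_fun I h /\ exists c, forall s, I s -> `|h s| <= c * phi s.

Definition kerop (h : R -> R) (t : R) : R := Rintegral mu I (fun s => k t s * h s).

(** The first summand controls the value of [kerop h] at 0, the second its variation. *)
Definition kerbound (h : R -> R) : R :=
  Rintegral mu I (fun s => (`|k 0 s| + m s) * `|h s|).

Let mI := @measurable_I01 R.
Let in0 : `[0, 1]%classic (0 : R). Proof. by rewrite /= in_itv /= lexx ler01. Qed.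

Lemma dominated_sub h h' : dominated h -> dominated h' -> dominated (fun s => h s - h' s).
Proof.
move=> [mh [c hc]] [mh' [c' hc']]; split; first exact: measurable_sub_I01.
exists (c + c') => s Is; rewrite (le_trans (ler_normB _ _)) // mulrDl lerD ?hc ?hc' //.
Qed.

Lemma dominated_norm h : dominated h -> dominated (fun s => `|h s|).
Proof.
move=> [mh [c hc]]; split; first exact: measurable_norm_I01.
by exists c => s Is; rewrite normr_id hc.
Qed.

Lemma integrable_dominatedM (g h : R -> R) : measurable_fun I g ->
  mu.-integrable I (EFin \o (fun s => `|g s| * phi s)) -> dominated h ->
  mu.-integrable I (EFin \o (fun s => g s * h s)).
Proof.
move=> mg ig [mh [c hc]].
apply: (@le_integrable_I01 _ _ (fun s => c * (`|g s| * phi s))).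
- exact: measurable_mul_I01.
- by move=> s Is; rewrite normrM mulrCA ler_wpM2l // hc.
- exact: (integrableZ_I01 c ig).
Qed.

Lemma integrable_kerop h t : `[0, 1]%classic t -> dominated h ->
  mu.-integrable I (EFin \o (fun s => k t s * h s)).
Proof. by move=> t01; apply: integrable_dominatedM; [exact: mk|exact: ik]. Qed.

Let integrable_knorm h t : `[0, 1]%classic t -> dominated h ->
  mu.-integrable I (EFin \o (fun s => `|k t s| * `|h s|)).
Proof.
move=> t01 dh; apply: integrable_dominatedM (dominated_norm dh).
  by apply: measurable_norm_I01; exact: mk.
by have := ik t01; apply: eq_integrable_I01 => s; rewrite normr_id.
Qed.

Let integrable_m h : dominated h -> mu.-integrable I (EFin \o (fun s => m s * `|h s|)).
Proof.
move=> dh; apply: integrable_dominatedM (dominated_norm dh) => //.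
by have := im; apply: eq_integrable_I01 => s; rewrite ger0_norm.
Qed.

Lemma integrable_kerdiff h t t' : `[0, 1]%classic t -> `[0, 1]%classic t' -> dominated h ->
  mu.-integrable I (EFin \o (fun s => `|k t s - k t' s| * `|h s|)).
Proof.
move=> t01 t'01 dh; apply: (@le_integrable_I01 _ _ (fun s => `|k t s| * `|h s| + `|k t' s| * `|h s|)).
- apply: measurable_mul_I01; last exact: (dominated_norm dh).1.
  by apply: measurable_norm_I01; apply: measurable_sub_I01; exact: mk.
- by move=> s Is; rewrite normrM !normr_id -mulrDl ler_wpM2r // ler_normB.
- exact: (integrableD_I01 (integrable_knorm t01 dh) (integrable_knorm t'01 dh)).
Qed.

Lemma kerop_sub h h' t : `[0, 1]%classic t -> dominated h -> dominated h' ->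
  kerop (fun s => h s - h' s) t = kerop h t - kerop h' t.
Proof.
move=> t01 dh dh'; rewrite /kerop -RintegralB //; try exact: integrable_kerop.
by apply: eq_Rintegral => s _; rewrite mulrBr.
Qed.

Lemma kerop_diff h t t' : `[0, 1]%classic t -> `[0, 1]%classic t' -> dominated h ->
  `|kerop h t - kerop h t'| <= Rintegral mu I (fun s => `|k t s - k t' s| * `|h s|).
Proof.
move=> t01 t'01 dh; rewrite /kerop -RintegralB //; try exact: integrable_kerop.
have e : mu.-integrable I (EFin \o (fun s => k t s * h s - k t' s * h s)).
  exact: (integrableB_I01 (integrable_kerop t01 dh) (integrable_kerop t'01 dh)).
rewrite (le_trans (le_normr_Rintegral mI e)) // le_eqVlt; apply/orP; left; apply/eqP.
by apply: eq_Rintegral => s _; rewrite -mulrBl normrM.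
Qed.

Lemma kerop_equicontinuous h c t t' : 0 <= c -> measurable_fun I h ->
  (forall s, I s -> `|h s| <= c * phi s) ->
  `[0, 1]%classic t -> `[0, 1]%classic t' ->
  `|kerop h t - kerop h t'| <= c * Rintegral mu I (fun s => `|k t s - k t' s| * phi s).
Proof.
move=> c0 mh hc t01 t'01; have dh : dominated h by split=> //; exists c.
have dphi : dominated phi by split=> //; exists 1 => s _; rewrite mul1r ger0_norm.
have ip : mu.-integrable I (EFin \o (fun s => `|k t s - k t' s| * phi s)).
  by have := integrable_kerdiff t01 t'01 dphi; apply: eq_integrable_I01 => s; rewrite (ger0_norm (phi_ge0 s)).
rewrite (le_trans (kerop_diff t01 t'01 dh)) // -RintegralZl //; apply: le_Rintegral => //.
- exact: integrable_kerdiff.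
- exact: (integrableZ_I01 c ip).
- by move=> s Is; rewrite mulrCA ler_wpM2l // hc.
Qed.

Lemma Rintegral_kdiff_cvg tau : `[0, 1]%classic tau ->
  Rintegral mu I (fun s => `|k t s - k tau s| * phi s)
    @[t --> within (`[0, 1]%classic : set R) (nbhs tau)] --> (0 : R).
Proof. by move=> /(kernel_cvg kA) /fine_cvgP[]. Qed.

(** Under the integral sign the increments add up to a variation of k(.,s), at most m(s) for almost
    every s. *)
Let variation_kerop h s : dominated h -> itv_partition 0 1 s ->
  variation 0 1 (kerop h) s <= Rintegral mu I (fun x => m x * `|h x|).
Proof.
move=> dh sP.
have pt i : (i <= size s)%N -> `[0, 1]%classic (nth 1 (0 :: s) i).
  by move=> si; rewrite /= in_itv /=; exact: itv_partition_nth sP si.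
pose V (r : seq nat) x := \sum_(i <- r) `|k (nth 1 (0 :: s) i.+1) x - k (nth 1 (0 :: s) i) x| * `|h x|.
have main (r : seq nat) : {in r, forall i, (i < size s)%N} ->
    mu.-integrable I (EFin \o V r) /\
    \sum_(i <- r) `|kerop h (nth 1 (0 :: s) i.+1) - kerop h (nth 1 (0 :: s) i)|
      <= Rintegral mu I (V r).
  elim: r => [|i r IH] rs.
    split.
      by apply: (@eq_integrable_I01 _ (fun=> 0)) => [x|]; [rewrite /V big_nil|exact: integrable0].
    by rewrite big_nil Rintegral_ge0 // => x _; rewrite /V big_nil.
  have [|ir le] := IH; first by move=> j jr; apply: rs; rewrite inE jr orbT.
  have si : (i < size s)%N by apply: rs; rewrite inE eqxx.
  have ii := integrable_kerdiff (pt i.+1 si) (pt i (ltnW si)) dh.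
  have VE : V (i :: r) = fun x => `|k (nth 1 (0 :: s) i.+1) x - k (nth 1 (0 :: s) i) x| * `|h x| + V r x.
    by apply/funext => x; rewrite /V big_cons.
  split; first by rewrite VE; exact: (integrableD_I01 ii ir).
  rewrite big_cons VE RintegralD // lerD //; apply: kerop_diff => //; first exact: pt si.
  exact: pt (ltnW si).
have [|iV le] := main (index_iota 0 (size s)).
  by move=> i; rewrite mem_index_iota => /andP[].
rewrite (le_trans le) //; apply: ae_le_Rintegral_I01 => //.
- exact: integrable_m.
- by move=> x _; rewrite /V sumr_ge0 // => i _; rewrite mulr_ge0.
- by move=> x _; rewrite mulr_ge0.
apply: filterS (kernel_variation_le kA) => x vx Ix; rewrite /V -mulr_suml ler_wpM2r // -lee_fin.
apply: le_trans (vx Ix); apply: ereal_sup_ubound.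
by exists (variation 0 1 (fun t => k t x) s) => //; exact: variations_variation.
Qed.

Lemma kerop_isCBV h : dominated h -> isCBV (kerop h) /\ bvnorm (kerop h) <= kerbound h.
Proof.
move=> dh; have [|bv le] := @variation_bound _ (kerop h) (Rintegral mu I (fun x => m x * `|h x|)).
  by move=> s; exact: variation_kerop.
split.
  split=> //; apply/subspace_continuousP => tau tau01; apply/cvgrPdistC_lt => e e0.
  have [mh [c hc]] := dh.
  have hc' s : I s -> `|h s| <= `|c| * phi s.
    by move=> /hc h1; rewrite (le_trans h1) // ler_wpM2r // ler_norm.
  (* The added 1 keeps the divisor positive when [c] is 0. *)
  have c0 : 0 < `|c| + 1 by rewrite ltr_wpDl.
  have := Rintegral_kdiff_cvg tau01 => /cvgr0Pnorm_lt /(_ (e / (`|c| + 1)) (divr_gt0 e0 c0)).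
  rewrite !near_withinE; apply: filterS => t ht t01; have := ht t01.
  rewrite ltr_pdivlMr // => {}ht.
  rewrite (le_lt_trans (kerop_equicontinuous (normr_ge0 c) mh hc' t01 tau01)) //.
  rewrite (le_lt_trans _ ht) // mulrC ler_pM // ?lerDl ?ler_norm //.
  by apply: Rintegral_ge0 => s _; rewrite mulr_ge0.
have -> : kerbound h = Rintegral mu I (fun s => `|k 0 s| * `|h s|) + Rintegral mu I (fun s => m s * `|h s|).
  rewrite -RintegralD //; [|exact: integrable_knorm|exact: integrable_m].
  by apply: eq_Rintegral => s _; rewrite mulrDl.
rewrite /bvnorm lerD // (le_trans (le_normr_Rintegral mI (integrable_kerop in0 dh))) //.
by rewrite le_eqVlt; apply/orP; left; apply/eqP; apply: eq_Rintegral => s _; rewrite normrM.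
Qed.

Let integrable_bound : mu.-integrable I (EFin \o (fun s => (`|k 0 s| + m s) * phi s)).
Proof.
by have := integrableD_I01 (ik in0) im; apply: eq_integrable_I01 => s; rewrite mulrDl.
Qed.

Lemma kerbound_le h c : measurable_fun I h -> (forall s, I s -> `|h s| <= c * phi s) ->
  kerbound h <= c * Rintegral mu I (fun s => (`|k 0 s| + m s) * phi s).
Proof.
move=> mh hc; have dh : dominated h by split=> //; exists c.
rewrite -RintegralZl //; apply: le_Rintegral => //.
- have := integrableD_I01 (integrable_knorm in0 dh) (integrable_m dh).
  by apply: eq_integrable_I01 => s; rewrite mulrDl.
- exact: (integrableZ_I01 c integrable_bound).
- by move=> s Is; rewrite mulrCA ler_wpM2l ?addr_ge0 // hc.
Qed.

(** Dominated convergence with majorant c (|k(0,s)| + m(s)) phi(s). *)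
Lemma kerbound_cvg0 (h : nat -> R -> R) c :
  (forall n, measurable_fun I (h n)) ->
  (forall n s, I s -> `|h n s| <= c * phi s) ->
  {ae mu, forall s : @lebT R, I s -> h n s @[n --> \oo] --> 0} ->
  kerbound (h n) @[n --> \oo] --> 0.
Proof.
move=> mh hc h0; have mg : measurable_fun I (fun s : @lebT R => `|k 0 s| + m s).
  by apply: measurable_add_I01; [apply: measurable_norm_I01; exact: mk|exact: mm].
have [|||||_ _] := @dominated_convergence _ _ _ mu I mI
  (fun n s => ((`|k 0 s| + m s) * `|h n s|)%:E) (fun=> 0%E)
  (EFin \o (fun s => c * ((`|k 0 s| + m s) * phi s))).
- move=> n; apply/measurable_EFinP; apply: measurable_mul_I01; first exact: mg.
  by apply: measurable_norm_I01; exact: mh.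
- exact: measurable_cst.
- apply: filterS h0 => s + Is => /(_ Is) hs; apply: cvg_EFin; first by apply: nearW.
  rewrite -[X in _ --> X](mulr0 (`|k 0 s| + m s)); apply: cvgMr.
  by rewrite -(normr0 R); apply: cvg_norm.
- exact: (integrableZ_I01 c integrable_bound).
- apply: aeW => s n Is; rewrite /= lee_fin ger0_norm ?mulr_ge0 ?addr_ge0 //.
  by rewrite mulrCA ler_wpM2l ?addr_ge0 // hc.
by rewrite integral0 => /fine_cvgP[].
Qed.

End KernelOperator.

(** * Products of functions with conjugate exponents *)

Section Young.
Context {R : realType}.
Local Notation mu := (@leb R).
Local Notation I := (@I01 R).

Lemma integrable_powR_I01 (q : R) (g : R -> R) : inLp q%:E g ->
  mu.-integrable I (EFin \o (fun s => `|g s| `^ q)).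
Proof.
move=> [mg fin]; apply/integrableP; split.
  apply/measurable_EFinP; apply: (measurableT_comp (measurable_powR q)).
  exact: measurable_norm_I01.
apply: le_lt_trans fin; rewrite le_eqVlt; apply/orP; left; apply/eqP.
by apply: eq_integral => s _; rewrite /= ger0_norm // powR_ge0.
Qed.

(** Young's inequality gives an integrable majorant; for p infinite the majorant is a multiple of
    |g|, valid almost everywhere. *)
Lemma integrable_conjugate (p : \bar R) (q : R) (g h : R -> R) :
  (1 < p)%E -> 1 <= q ->
  (p = +oo%E /\ q = 1) \/ (exists r : R, p = r%:E /\ r^-1 + q^-1 = 1) ->
  inLp q%:E g -> inLp p h ->
  mu.-integrable I (EFin \o (fun s => `|g s| * `|h s|)).
Proof.
move=> p1 q1 pq gq hp; have mI := @measurable_I01 R.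
have mgh : measurable_fun I (fun s : @lebT R => `|g s| * `|h s|).
  by apply: measurable_mul_I01; apply: measurable_norm_I01; [exact: gq.1|exact: hp.1].
have ig := integrable_powR_I01 gq.
case: pq => [[pE qE]|[r [pE rq]]]; subst p.
  have [mh [M hM]] := hp; rewrite qE in ig.
  have := integrableZ_I01 `|M| ig => /integrableP[mb fin].
  apply/integrableP; split; first exact/measurable_EFinP.
  apply: le_lt_trans fin; apply: ae_ge0_le_integral; first exact: mI.
  - by move=> s _; exact: abse_ge0.
  - by apply: measurableT_comp; [exact: abse_measurable|exact/measurable_EFinP].
  - by move=> s _; exact: abse_ge0.
  - by apply: measurableT_comp; [exact: abse_measurable|exact: mb].
  - apply: filterS hM => s hs Is; rewrite /= lee_fin powRr1 // mulrC !normrM !normr_id.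
    by rewrite ler_wpM2r // (le_trans (hs Is)) // ler_norm.
have r1 : 1 < r by rewrite lte_fin in p1.
have q0 : 0 < q by apply: lt_le_trans q1.
apply: (@le_integrable_I01 _ _ (fun s => q^-1 * `|g s| `^ q + r^-1 * `|h s| `^ r)) => //.
- move=> s Is; rewrite ger0_norm ?mulr_ge0 // ![_^-1 * _]mulrC.
  by apply: conjugate_powR => //; [exact: lt_trans r1|rewrite addrC].
- apply: integrableD_I01; apply: integrableZ_I01 => //.
  exact: integrable_powR_I01.
Qed.

End Young.

(** * Superposition operators *)

(** The Heine-Cantor argument for an abstract modulus [D], which is later |g u - g v| or the
    combined modulus of w and the kernel. *)
Lemma uniform_modulus (R : realType) (a b : R) (D : R -> R -> R) :
  (forall t u v, t \in `[a, b] -> u \in `[a, b] -> v \in `[a, b] ->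
     D u v <= D u t + D v t) ->
  (forall t, t \in `[a, b] -> D u t @[u --> within (`[a, b]%classic : set R) (nbhs t)] --> (0 : R)) ->
  forall e, 0 < e -> exists2 d, 0 < d &
    forall u v, u \in `[a, b] -> v \in `[a, b] -> `|u - v| < d -> D u v < e.
Proof.
move=> tri loc e e0; have e2 : 0 < e / 2 by lra.
have /compact_near_coveringP/near_covering_withinP := @segment_compact R a b.
move=> /(_ _ (0 : R)^'+ (fun d u => forall v, v \in `[a, b] -> `|u - v| < d -> D u v < e)) [].
  move=> t t01; have /cvgr_lt := loc t t01 => /(_ _ e2).
  rewrite near_withinE => -[eta /= eta0 near_t].
  (* Halving [eta] keeps both u and any v within [d] of u inside the neighbourhood of t where [D] is
     below [e / 2]. *)
  exists (ball t (eta / 2), [set d : R | d < eta / 2]) => /=.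
    split; first by apply: nbhsx_ballx; rewrite divr_gt0.
    by apply: nbhs_right_lt; rewrite divr_gt0.
  move=> [u d] /= [tu du] u01 v v01 uv.
  rewrite /ball /= in tu; have tu' : `|t - u| < eta by apply: lt_trans tu _; lra.
  have tv : `|t - v| < eta.
    by rewrite (le_lt_trans (ler_distD u _ _)) //; have := lt_trans uv du; lra.
  rewrite (le_lt_trans (tri t u v t01 u01 v01)) //.
  by have := near_t u tu' u01; have := near_t v tv v01; lra.
move=> d0 /= d00 H; exists (d0 / 2); first by rewrite divr_gt0.
move=> u v u01 v01; apply: H => //=; last by rewrite divr_gt0.
by rewrite sub0r normrN gtr0_norm ?divr_gt0 //; move: d00 => /=; lra.
Qed.

(** Neither sequence need converge; uniform continuity of [g] on [-r, r] suffices. *)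
Lemma continuous_sub_cvg0 (R : realType) (g : R -> R) (r : R) (u v : nat -> R) :
  continuous g -> (forall n, `|u n| <= r) -> (forall n, `|v n| <= r) ->
  u n - v n @[n --> \oo] --> 0 -> g (u n) - g (v n) @[n --> \oo] --> 0.
Proof.
move=> gc ur vr uv; apply/cvgr0Pnorm_lt => e e0.
have [||d d0 H] := @uniform_modulus R (- r) r (fun x y => `|g x - g y|) _ _ e e0.
- by move=> t x y _ _ _; rewrite (le_trans (ler_distD (g t) _ _)) // (distrC (g t)).
- move=> t _; apply: cvg_within_filter; apply/norm_cvg0P; apply/subr_cvg0; exact: gc.
have /cvgr0Pnorm_lt /(_ d d0) := uv; apply: filterS => n.
by apply: H; rewrite in_itv /= -ler_norml.
Qed.

Record caratheodory {R : realType} (f : R -> R -> R) (psi phi : R -> R) : Prop := {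
  caratheodory_measurable : forall u, measurable_fun (@I01 R) (fun t => f t u);
  caratheodory_continuous :
    {ae (@leb R), forall t : @lebT R, `[0, 1]%classic t -> continuous (f t)};
  growth_ge0 : forall r, 0 <= r -> 0 <= psi r;
  growth_le : forall r s, 0 <= r -> r <= s -> psi r <= psi s;
  weight_ge0 : forall s, 0 <= phi s;
  caratheodory_le : forall t u, `[0, 1]%classic t -> `|f t u| <= phi t * psi `|u| }.

Section Nemytskii.
Context {R : realType}.
Local Notation mu := (@leb R).
Local Notation I := (@I01 R).
Variables (f : R -> R -> R) (psi phi : R -> R).
Hypothesis fA : caratheodory f psi phi.
Implicit Types (x y z : R -> R) (r : R).

Definition nemytskii x : R -> R := fun s => f s (x s).

(** Measurability is required of the superposition rather than of [x]: this is what the integral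
    needs, and it is direct for step functions and stable under pointwise limits. *)
Definition admissible r x :=
  measurable_fun I (nemytskii x) /\ forall s, s \in `[0, 1] -> `|x s| <= r.

Lemma nemytskii_le r x s : admissible r x -> I s -> `|nemytskii x s| <= psi r * phi s.
Proof.
move=> [_ xr] Is; rewrite (le_trans (caratheodory_le fA _ Is)) // mulrC.
rewrite ler_wpM2r ?(weight_ge0 fA) //; apply: (growth_le fA) => //; exact: xr.
Qed.

Lemma admissible_dominated r x : admissible r x -> dominated phi (nemytskii x).
Proof. by move=> ax; split; [exact: ax.1|exists (psi r) => s; exact: nemytskii_le]. Qed.

Lemma grid_cellE n (i : 'I_n.+2) :
  I `&` [set s : @lebT R | grid_index n s == i] =
  I `&` (`[grid_point n i, grid_point n i.+1[%classic : set R).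
Proof.
have N0 : 0 < n.+1%:R :> R by rewrite ltr0n.
have eqv s : I s -> (grid_index n s == i) = (s \in `[grid_point n i, grid_point n i.+1[).
  rewrite /I01 /= in_itv /= => /andP[s0 s1].
  have Ns0 : 0 <= n.+1%:R * s by rewrite mulr_ge0 // ltW.
  have /andP[h1 h2] := truncn_itv Ns0.
  have le : (Num.truncn (n.+1%:R * s) < n.+2)%N.
    by rewrite ltnS -(ler_nat R) (le_trans h1) // ler_piMr // ltW.
  rewrite in_itv /= /grid_point ler_pdivrMr // ltr_pdivlMr // ![s * _]mulrC.
  by rewrite -truncn_eq // -(inj_eq val_inj) /= /grid_index inordK.
by apply/seteqP; split=> s [Is /=]; [rewrite eqv|rewrite -eqv].
Qed.

(** On each cell the second argument of [f] is a constant, and there are finitely many cells. *)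
Lemma nemytskii_step_measurable n (c : 'I_n.+2 -> R) :
  measurable_fun I (nemytskii (step c)).
Proof.
have mI := @measurable_I01 R.
pose g (i : 'I_n.+2) (s : @lebT R) : R := if grid_index n s == i then f s (c i) else 0.
have mg i : measurable_fun I (g i).
  apply: measurable_fun_if; first exact: mI.
  - apply: (measurable_fun_bool true).
    rewrite (_ : _ `&` _ = I `&` [set s : @lebT R | grid_index n s == i]); last first.
      by apply/seteqP; split=> s [Is h]; split.
    rewrite grid_cellE; apply: measurableI; first exact: mI.
    by apply: measurable_lebT; exact: measurable_itv.
  - by apply: measurable_funS (caratheodory_measurable fA (c i)); [exact: mI|exact: subIsetl].
  - exact: measurable_cst.
have -> : nemytskii (step c) = fun s => \sum_(i < n.+2) g i s.
  apply/funext => s; rewrite (bigD1 (grid_index n s)) //= /g eqxx big1 ?addr0 //.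
  by move=> i /negPf; rewrite eq_sym => ->.
by apply: measurable_sum => i; exact: mg.
Qed.

Lemma admissible_step r n (c : 'I_n.+2 -> R) :
  (forall i, `|c i| <= r) -> admissible r (step c).
Proof. by move=> cr; split; [exact: nemytskii_step_measurable|move=> s _; exact: cr]. Qed.

Lemma admissible_lim r (x : nat -> R -> R) z : (forall n, admissible r (x n)) ->
  (forall t, t \in `[0, 1] -> x n t @[n --> \oo] --> z t) -> admissible r z.
Proof.
move=> xA xz; split.
  apply: (ae_measurable_cvg_I01 (f := fun n => nemytskii (x n))) => [n|]; first exact: (xA n).1.
  apply: filterS (caratheodory_continuous fA) => s fcs Is; have := fcs Is (z s); apply: cvg_comp; exact: xz.
move=> s s01; apply: (cvgr_to_le (cvg_norm (xz s s01))).
by apply: nearW => n; exact: (xA n).2.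
Qed.

Lemma nemytskii_sub_cvg0 r (x y : nat -> R -> R) :
  (forall n, admissible r (x n)) -> (forall n, admissible r (y n)) ->
  (forall t, t \in `[0, 1] -> x n t - y n t @[n --> \oo] --> 0) ->
  {ae mu, forall s : @lebT R, I s -> nemytskii (x n) s - nemytskii (y n) s @[n --> \oo] --> 0}.
Proof.
move=> xA yA xy; apply: filterS (caratheodory_continuous fA) => s fcs Is.
apply: (continuous_sub_cvg0 (r := r) (fcs Is)); last exact: xy.
  by move=> n; exact: (xA n).2.
by move=> n; exact: (yA n).2.
Qed.

End Nemytskii.

(** * Existence of a solution *)

(** The weight phi is nonnegative only almost everywhere; replacing it by |phi| leaves the integrals
    unchanged. *)
Lemma kernel_modulus_cvg (R : realType) (k : R -> R -> R) (phi : R -> R) (tau : R) :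
  (forall t, `[0, 1]%classic t -> measurable_fun (@I01 R) (k t)) ->
  measurable_fun (@I01 R) phi ->
  {ae (@leb R), forall t : @lebT R, `[0, 1]%classic t -> 0 <= phi t} ->
  `[0, 1]%classic tau ->
  (fun t => (\int[@leb R]_(s in (@I01 R)) (`|k t s - k tau s| * phi s)%:E)%E)
    @ within (`[0, 1]%classic : set R) (nbhs tau) --> 0%:E ->
  (fun t => (\int[@leb R]_(s in (@I01 R)) (`|k t s - k tau s| * `|phi s|)%:E)%E)
    @ within (`[0, 1]%classic : set R) (nbhs tau) --> 0%:E.
Proof.
move=> mk mphi phi0 tau01; apply: cvg_trans; apply: near_eq_cvg.
rewrite near_withinE; apply: nearW => t t01; have mI := @measurable_I01 R.
have md : measurable_fun (@I01 R) (fun s : @lebT R => `|k t s - k tau s|).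
  by apply: measurable_norm_I01; apply: measurable_sub_I01; exact: mk.
apply: ae_eq_integral; first exact: mI.
- by apply/measurable_EFinP; apply: measurable_mul_I01; [exact: md|exact: mphi].
- by apply/measurable_EFinP; apply: measurable_mul_I01; [exact: md|exact: measurable_norm_I01].
- by apply: filterS phi0 => s h Is; rewrite (ger0_norm (h Is)).
Qed.

(** Supplies the radius of the invariant ball: psi r / r is eventually below 1 / (c + 1), where the
    1 covers c = 0. *)
Lemma sublinear_bound (R : realType) (psi : R -> R) (c : R) : 0 <= c ->
  (fun r => psi r / r) @ +oo --> 0 -> exists2 r, 0 < r & c * psi r <= r.
Proof.
move=> c0 lim; have c1 : 0 < c + 1 by rewrite ltr_wpDl.
have ci : 0 < (c + 1)^-1 by rewrite invr_gt0.
have /cvgr_lt /(_ _ ci) H := lim.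
have [r [h r0]] := filter_ex (filterI H (nbhs_pinfty_gt (num_real (0 : R)))).
exists r => //; rewrite /= in h; move: h; rewrite ltr_pdivrMr // mulrC ltr_pdivlMr // => h.
have [p0|p0] := leP 0 (psi r); first lra.
by rewrite (le_trans _ (ltW r0)) // mulr_ge0_le0 // ltW.
Qed.

Section Assembly.
Context {R : realType}.
Local Notation mu := (@leb R).
Local Notation I := (@I01 R).
Variables (f : R -> R -> R) (psi phi : R -> R) (k : R -> R -> R) (m w : R -> R).
Hypothesis fA : caratheodory f psi phi.
Hypothesis kA : admissible_kernel k phi m.
Hypothesis psi_sub : (fun r => psi r / r) @ +oo --> 0.
Hypothesis wB : isCBV w.

Variables (C : R) (S : (R -> R) -> R -> R).
Hypothesis C_ge0 : 0 <= C.
Hypothesis S_le : forall y, isCBV y -> forall t, t \in `[0, 1] -> `|S y t| <= C * bvnorm y.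
Hypothesis S_lip : forall y y', isCBV y -> isCBV y' -> forall t, t \in `[0, 1] ->
  `|S y t - S y' t| <= C * bvnorm (fun s => y s - y' s).
Hypothesis S_equi : forall y, isCBV y -> forall t t', t \in `[0, 1] -> t' \in `[0, 1] ->
  `|S y t - S y t'| <= C * bvnorm y * `|w t - w t'| + `|y t - y t'|.

Let phi_ge0 := weight_ge0 fA.
Let m_ge0 := kernel_variation_ge0 kA.
Let mphi := kernel_weight_measurable kA.

Let F x := kerop k (nemytskii f x).
Let B := Rintegral mu I (fun s => (`|k 0 s| + m s) * phi s).
Let Dk t t' := Rintegral mu I (fun s => `|k t s - k t' s| * phi s).

Let adm_dom r x : admissible f r x -> dominated phi (nemytskii f x).
Proof. exact: (admissible_dominated fA). Qed.

Let B_ge0 : 0 <= B.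
Proof. by apply: Rintegral_ge0 => s _; rewrite mulr_ge0 // addr_ge0. Qed.

Let F_isCBV r x : admissible f r x -> isCBV (F x).
Proof. by move=> /adm_dom dx; have [] := kerop_isCBV kA dx. Qed.

Let F_le r x : admissible f r x -> bvnorm (F x) <= psi r * B.
Proof.
move=> ax; have [_ h] := kerop_isCBV kA (adm_dom ax).
rewrite (le_trans h) //.
apply: (kerbound_le kA); first exact: ax.1.
by move=> s; exact: (nemytskii_le fA ax).
Qed.

Let F_sub r x y : admissible f r x -> admissible f r y ->
  bvnorm (fun s => F x s - F y s) <= kerbound k m (fun s => nemytskii f x s - nemytskii f y s).
Proof.
move=> ax ay; have dx := adm_dom ax; have dy := adm_dom ay.
have [b h] := kerop_isCBV kA (dominated_sub dx dy).
have [_ e] : isCBV (fun s => F x s - F y s) /\ bvnorm (kerop k (fun s => nemytskii f x s - nemytskii f y s)) = bvnorm (fun s => F x s - F y s).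
  by apply: isCBV_eq_on b => t t01; exact: (kerop_sub kA).
by rewrite -e.
Qed.

(** A failure yields pairs at sup distance at most 1 / (n + 1) whose images stay apart in BV norm.
    Their superpositions differ by a dominated sequence tending to 0 almost everywhere, so
    [kerbound_cvg0] contradicts this. *)
Let F_unif r e : 0 < e -> exists2 d, 0 < d & forall x y, admissible f r x -> admissible f r y ->
  (forall t, t \in `[0, 1] -> `|x t - y t| <= d) -> bvnorm (fun s => F x s - F y s) <= e.
Proof.
move=> e0; apply: contrapT => nH.
have bad (n : nat) : exists xy : (R -> R) * (R -> R), [/\ admissible f r xy.1, admissible f r xy.2,
    forall t, t \in `[0, 1] -> `|xy.1 t - xy.2 t| <= n.+1%:R^-1 &
    e < bvnorm (fun s => F xy.1 s - F xy.2 s)].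
  apply: contrapT => nxy; apply: nH; exists n.+1%:R^-1; first by rewrite invr_gt0 ltr0n.
  move=> x y ax ay xy; rewrite leNgt; apply/negP => h; apply: nxy; by exists (x, y).
have [xy xyP] := choice bad.
pose h n s := nemytskii f (xy n).1 s - nemytskii f (xy n).2 s.
have h0 : kerbound k m (h n) @[n --> \oo] --> 0.
  apply: (kerbound_cvg0 kA (c := psi r + psi r)).
  - move=> n; have [a1 a2 _ _] := xyP n; apply: measurable_sub_I01; [exact: a1.1|exact: a2.1].
  - move=> n s Is; have [a1 a2 _ _] := xyP n; rewrite (le_trans (ler_normB _ _)) // mulrDl.
    by rewrite lerD // (nemytskii_le fA).
  - apply: (nemytskii_sub_cvg0 fA (r := r)) => [n|n|t t01].
    + by have [] := xyP n.
    + by have [] := xyP n.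
    + apply/cvgr0Pnorm_lt => d d0; near=> n; have [_ _ xyn _] := xyP n.
      rewrite (le_lt_trans (xyn t t01)) //; near: n.
      by have := near_infty_natSinv_lt (PosNum d0).
have /cvgr_lt /(_ e e0) /filter_ex [n hn] := h0.
have [a1 a2 _] := xyP n; have := F_sub a1 a2; move=> h1 h2.
by have := lt_le_trans h2 h1; rewrite ltNge (ltW hn).
Unshelve. all: by end_near. Qed.

Lemma exists_solution : exists x, [/\ isCBV (F x), dominated phi (nemytskii f x) &
  forall t, t \in `[0, 1] -> S (F x) t = x t].
Proof.
have CB0 : 0 <= C * B by rewrite mulr_ge0.
have [r r0 rP] := sublinear_bound CB0 psi_sub.
have pr0 : 0 <= psi r by rewrite (growth_ge0 fA) // ltW.
have [||||||z zA zP] := @exists_fixed_point R r (admissible f r) (fun x => S (F x)).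
- exact: r0.
- by move=> n c cr; apply: (admissible_step fA).
- move=> x ax t t01; rewrite (le_trans (S_le (F_isCBV ax) t01)) // (le_trans _ rP) //.
  by rewrite -mulrA ler_wpM2l // mulrC F_le.
- move=> e e0; have C1 : 0 < C + 1 by rewrite ltr_wpDl.
  have [d d0 dP] := F_unif r (divr_gt0 e0 C1); exists d => // x y ax ay xy t t01.
  rewrite (le_trans (S_lip (F_isCBV ax) (F_isCBV ay) t01)) //.
  apply: (@le_trans _ _ ((C + 1) * (e / (C + 1)))); last by rewrite mulrC divfK // gt_eqF.
  by apply: ler_pM => //; [exact: bvnorm_ge0|rewrite lerDl|exact: dP].
- move=> e e0; pose c := C * (psi r * B).
  have c0 : 0 <= c by rewrite !mulr_ge0.
  (* A modulus for all [S (F x)] at once: it depends on [r] but not on [x]. *)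
  have [||d d0 dP] := @uniform_modulus R 0 1 (fun t t' => c * `|w t - w t'| + psi r * Dk t t') _ _ e e0.
  + move=> t u v t01 u01 v01; rewrite addrACA -!mulrDr lerD // ler_wpM2l //.
      by rewrite (le_trans (ler_distD (w t) _ _)) // (distrC (w t)).
    have dphi : dominated phi phi by split=> //; exists 1 => s _; rewrite mul1r ger0_norm.
    have id a b : a \in `[0, 1] -> b \in `[0, 1] ->
        mu.-integrable I (EFin \o (fun s => `|k a s - k b s| * phi s)).
      move=> a01 b01; have := integrable_kerdiff kA a01 b01 dphi.
      by apply: eq_integrable_I01 => s; rewrite (ger0_norm (phi_ge0 s)).
    rewrite /Dk -RintegralD; [|exact: measurable_I01|exact: id|exact: id].
    apply: le_Rintegral; [exact: measurable_I01|exact: id|apply: integrableD_I01; exact: id|].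
    move=> s _; rewrite -mulrDl ler_wpM2r //.
    by rewrite (le_trans (ler_distD (k t s) _ _)) // (distrC (k t s)).
  + move=> t t01; rewrite -[X in _ --> X](addr0 0); apply: cvgD.
      rewrite -[X in _ --> X](mulr0 c); apply: cvgMr; apply/norm_cvg0P; apply/subr_cvg0.
      by have /subspace_continuousP := wB.1; apply.
    rewrite -[X in _ --> X](mulr0 (psi r)); apply: cvgMr; exact: (Rintegral_kdiff_cvg kA).
  exists d => // x ax t t' t01 t'01 tt'.
  rewrite (le_trans _ (ltW (dP t t' t01 t'01 tt'))) // (le_trans (S_equi (F_isCBV ax) t01 t'01)) //.
  apply: lerD; first by rewrite ler_wpM2r // /c ler_wpM2l // F_le.
  apply: (kerop_equicontinuous kA pr0 ax.1) => //.
  by move=> s; exact: (nemytskii_le fA ax).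
- by move=> x y xA xy; exact: (admissible_lim fA xA xy).
by exists z; split=> //; [exact: F_isCBV zA|exact: adm_dom zA].
Qed.

End Assembly.
Theorem theorem4p9 (R : realType)
  (alpha beta : (R -> R) -> R) (v w : R -> R)
  (p : \bar R) (q : R)
  (f : R -> R -> R) (psi phi : R -> R)
  (k : R -> R -> R) (m : R -> R) :
  isCBVdual alpha -> isCBVdual beta ->
  isCBV v -> isCBV w ->
  (forall t, `[0, 1]%classic t -> v t + w t = 1) ->
  opnorm alpha + opnorm (fun x => alpha x - beta x) * bvnorm w < 1 ->
  (* p in (1,+oo], q in [1,+oo), 1/p + 1/q = 1 *)
  (1 < p)%E -> 1 <= q ->
  ((p = +oo%E /\ q = 1) \/ (exists r : R, p = r%:E /\ r^-1 + q^-1 = 1)) ->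
  (* Caratheodory conditions on f *)
  (forall u, measurable_fun (@I01 R) (fun t => f t u)) ->
  {ae (@leb R), forall t : @lebT R, `[0, 1]%classic t -> continuous (f t)} ->
  (forall r, 0 <= r -> 0 <= psi r) ->
  (forall r s, 0 <= r -> r <= s -> psi r <= psi s) ->
  inLp p phi ->
  {ae (@leb R), forall t : @lebT R, `[0, 1]%classic t -> 0 <= phi t} ->
  (forall t u, `[0, 1]%classic t -> `|f t u| <= phi t * psi `|u|) ->
  (fun r => psi r / r) @ +oo --> 0 ->
  (* conditions on the kernel k *)
  (forall t, `[0, 1]%classic t -> inLp q%:E (k t)) ->
  inLp q%:E m ->
  {ae (@leb R), forall s : @lebT R, `[0, 1]%classic s -> 0 <= m s} ->
  {ae (@leb R), forall s : @lebT R, `[0, 1]%classic s ->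
     (var01 (fun t => k t s) <= (m s)%:E)%E} ->
  (forall tau, `[0, 1]%classic tau ->
     (fun t => (\int[@leb R]_(s in (@I01 R))
                 (`|k t s - k tau s| * phi s)%:E)%E)
       @ within (`[0, 1]%classic : set R) (nbhs tau) --> 0%:E) ->
  exists x : R -> R, isCBV x /\
    forall t, `[0, 1]%classic t ->
      (@leb R).-integrable (@I01 R)
         (fun s => (k t s * f s (x s))%:E) /\
      x t = alpha x * v t + beta x * w t
            + Rintegral (@leb R) (@I01 R)
                (fun s => k t s * f s (x s)).
Proof.
move=> aD bD vB wB vw1 small p1 q1 pq mf fc psi_ge0 psi_le phiL phi_ge0 f_le psi_sub kL mL m_ge0 km kc.
have [C [S [C0 SP]]] := resolvent_exists aD bD wB vw1 small.
have mk t : `[0, 1]%classic t -> measurable_fun (@I01 R) (k t) by move=> /kL[].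
have norm_phi s : 0 <= `|phi s| by [].
have f_le' t u : `[0, 1]%classic t -> `|f t u| <= `|phi t| * psi `|u|.
  by move=> t01; rewrite (le_trans (f_le t u t01)) // ler_wpM2r ?psi_ge0 // ler_norm.
have ik t : `[0, 1]%classic t ->
    (@leb R).-integrable (@I01 R) (EFin \o (fun s => `|k t s| * `|phi s|)).
  by move=> t01; exact: integrable_conjugate p1 q1 pq (kL t t01) phiL.
have im := integrable_conjugate p1 q1 pq mL phiL.
have km' : {ae (@leb R), forall s : @lebT R, `[0, 1]%classic s ->
    (var01 (fun t => k t s) <= (`|m s|)%:E)%E}.
  by apply: filterS km => s h /h le; rewrite (le_trans le) // lee_fin ler_norm.
have kc' tau : `[0, 1]%classic tau ->
    (fun t => (\int[@leb R]_(s in (@I01 R)) (`|k t s - k tau s| * `|phi s|)%:E)%E)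
      @ within (`[0, 1]%classic : set R) (nbhs tau) --> 0%:E.
  by move=> tau01; exact: kernel_modulus_cvg mk phiL.1 phi_ge0 tau01 (kc tau tau01).
have mphi := measurable_norm_I01 phiL.1; have mm := measurable_norm_I01 mL.1.
have fA : caratheodory f psi (fun s => `|phi s|) by split.
have kA : admissible_kernel k (fun s => `|phi s|) (fun s => `|m s|) by split.
have [|||x [FB dx xE]] := exists_solution fA kA psi_sub wB C0 (S := S).
- by move=> y /SP[].
- by move=> y y' yB y'B; have [_ _ _ h _] := SP y yB; exact: h.
- by move=> y /SP[].
set y := kerop k (nemytskii f x) in FB xE.
have [SB SE _ _ _] := SP y FB.
(* The solution returned is [S y], since the resolvent identity involves alpha and beta of this very
   function. It agrees with the fixed point [x] on [0,1], which is all that the integral sees. *)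
have yE : kerop k (nemytskii f (S y)) = y.
  apply/funext => t; apply: eq_Rintegral => s; rewrite inE => s01.
  by rewrite /nemytskii xE.
exists (S y); split=> // t t01; split.
  have := integrable_kerop kA t01 dx; apply: eq_integrable; first exact: measurable_I01.
  by move=> s; rewrite inE => s01; rewrite /= /nemytskii xE.
rewrite [LHS]SE //; congr (_ + _).
exact: (congr1 (@^~ t) (esym yE)).
Qed.
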